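(* Assume (A). Let $\bar v$ be a viscosity supersolution and $\underline v$ a viscosity subsolution of (E), both of class (L). Then $\underline v\le\bar v$ on $[0,\infty)$. Consequently, with $\hat v,v^*,v_*$ as in the context, $v^*=v_*=\hat v$, and this is the unique viscosity solution of class (L) of (E) on $[0,\infty)$.
   Context: Constants $\mu\in\mathbb R$, $\sigma>0$, $c>0$, $a>0$, $\lambda>0$; standing assumption (A): $a>\max\{1,2\mu\}$ and $\mu>\max\{c,\sigma^2/2\}$. $f(z)=\mu z+\lambda\ln\big[\lambda(e^{\frac{a}{\lambda}(1-z)}-1)/(1-z)\big]$ for $z\ne1$, $f(1)=\mu+\lambda\ln a$. (E) is $\frac12\sigma^2v''+f(v')-cv=0$ on $[0,\infty)$, $v(0)=0$. Viscosity sub/supersolution: upper (resp. lower) semicontinuous $u$ with $u(0)=0$ such that for all $x\in(0,\infty)$, $\varphi\in C^2(\mathbb R)$ with $0=(u-\varphi)(x)=\max_{(0,\infty)}(u-\varphi)$ (resp. $\min$): $\frac12\sigma^2\varphi''(x)+f(\varphi'(x))-cu(x)\ge0$ (resp. $\le0$); viscosity solution = continuous and both. Class (L): increasing and bounded on $[0,\infty)$. $\underline\psi(x)=1-e^{-x}$, $\overline\psi(x)=\frac AM(1-e^{-M(x\wedge b)})$ with $M,A,b$ chosen so that $\underline\psi$ is a viscosity subsolution, $\overline\psi$ a viscosity supersolution and $\underline\psi\le\overline\psi$. $\mathfrak F$ = continuous class (L) viscosity subsolutions $u$ with $\underline\psi\le u\le\overline\psi$; $\hat v=\sup_{u\in\mathfrak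 F}u$; $v^*,v_*$ are the upper and lower semicontinuous envelopes of $\hat v$. *)

(* Defs.v *)
From Stdlib Require Import Reals.
From Coquelicot Require Import Coquelicot.
Open Scope R_scope.

Definition assumptionA (mu sigma c a lambda : R) : Prop :=
  0 < sigma /\ 0 < c /\ 0 < a /\ 0 < lambda /\
  Rmax 1 (2 * mu) < a /\ Rmax c (sigma ^ 2 / 2) < mu.

Definition fH (mu a lambda : R) (z : R) : R :=
  if Req_EM_T z 1 then mu + lambda * ln a
  else mu * z + lambda * ln (lambda * (exp (a / lambda * (1 - z)) - 1) / (1 - z)).

Definition C2 (phi : R -> R) : Prop :=
  (forall x, ex_derive phi x) /\
  (forall x, ex_derive (Derive phi) x) /\
  (forall x, continuous (Derive (Derive phi)) x).

Definition usc_on (u : R -> R) : Prop :=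
  forall x, 0 <= x -> forall eps, 0 < eps -> exists delta, 0 < delta /\
    forall y, 0 <= y -> Rabs (y - x) < delta -> u y < u x + eps.
Definition lsc_on (u : R -> R) : Prop :=
  forall x, 0 <= x -> forall eps, 0 < eps -> exists delta, 0 < delta /\
    forall y, 0 <= y -> Rabs (y - x) < delta -> u x - eps < u y.
Definition cont_on (u : R -> R) : Prop :=
  forall x, 0 <= x -> forall eps, 0 < eps -> exists delta, 0 < delta /\
    forall y, 0 <= y -> Rabs (y - x) < delta -> Rabs (u y - u x) < eps.

Definition opE (mu sigma c a lambda : R) (phi : R -> R) (ux x : R) : R :=
  / 2 * sigma ^ 2 * Derive (Derive phi) x + fH mu a lambda (Derive phi x) - c * ux.

Definition visc_sub (mu sigma c a lambda : R) (u : R -> R) : Prop :=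
  usc_on u /\ u 0 = 0 /\
  forall x phi, 0 < x -> C2 phi ->
    u x - phi x = 0 -> (forall y, 0 < y -> u y - phi y <= u x - phi x) ->
    opE mu sigma c a lambda phi (u x) x >= 0.

Definition visc_super (mu sigma c a lambda : R) (u : R -> R) : Prop :=
  lsc_on u /\ u 0 = 0 /\
  forall x phi, 0 < x -> C2 phi ->
    u x - phi x = 0 -> (forall y, 0 < y -> u x - phi x <= u y - phi y) ->
    opE mu sigma c a lambda phi (u x) x <= 0.

Definition visc_sol (mu sigma c a lambda : R) (u : R -> R) : Prop :=
  cont_on u /\ visc_sub mu sigma c a lambda u /\ visc_super mu sigma c a lambda u.

Definition classL (u : R -> R) : Prop :=
  (forall x y, 0 <= x -> x <= y -> u x <= u y) /\
  (exists K, forall x, 0 <= x -> Rabs (u x) <= K).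

Definition psi_low (x : R) : R := 1 - exp (- x).
Definition psi_up (M A b : R) (x : R) : R := A / M * (1 - exp (- M * Rmin x b)).

Definition familyF (mu sigma c a lambda M A b : R) (u : R -> R) : Prop :=
  cont_on u /\ classL u /\ visc_sub mu sigma c a lambda u /\
  forall x, 0 <= x -> psi_low x <= u x /\ u x <= psi_up M A b x.

Definition vhat (mu sigma c a lambda M A b : R) (x : R) : R :=
  real (Lub_Rbar (fun r => exists u, familyF mu sigma c a lambda M A b u /\ r = u x)).

Definition usc_env (v : R -> R) (x : R) : R :=
  real (Glb_Rbar (fun s => exists d, 0 < d /\
    s = real (Lub_Rbar (fun r => exists y, 0 <= y /\ Rabs (y - x) < d /\ r = v y)))).
Definition lsc_env (v : R -> R) (x : R) : R :=
  real (Lub_Rbar (fun s => exists d, 0 < d /\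
    s = real (Glb_Rbar (fun r => exists y, 0 <= y /\ Rabs (y - x) < d /\ r = v y)))).

(* Main.v *)
Require Import Defs.
From Stdlib Require Import Reals Lra Psatz Classical FunctionalExtensionality.
From Coquelicot Require Import Coquelicot.
Open Scope R_scope.

(* The Hamiltonian is globally Lipschitz: [f z - mu z] is [lambda] times the logarithm of
   the integral over [0, a] of [exp ((1 - z) s / lambda)] in [s].

   Comparison.  In one dimension the theorem on sums can be avoided.  Comparing with
   parabolas shows that a bounded subsolution [u] and the opposite of a bounded
   supersolution [v] are locally semiconvex in the interior.  At a maximum point [x0] of
   [u - v - delta x] both functions therefore have supporting parabolas whose slopes
   match.  A second comparison with parabolas gives [u (x0 + h) >= u x0 + p h + alpha h^2 / 2]
   for every [alpha] below the value of [u''] dictated by the equation, and similarly for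
   [- v].  If [u - v > 0] at [x0] the two curvatures have a positive sum, contradicting
   maximality.

   Existence.  Elements of the Perron family are increasing and have a common one-sided
   Lipschitz constant, so their supremum is continuous and equal to both of its
   envelopes; it is the largest member of the family, and a bump argument that
   preserves monotonicity makes it a supersolution. *)

(** * Upper jets and quadratic barriers *)

(** Real induction: [E] holds the [x] for which a single value of [g] dominates [g] on [[a, x]]. If
    there is no maximum, some [z'] beats the supremum [s] of [E], and by semicontinuity [g z']
    dominates [g] near [s]. So [E] passes beyond [s] unless [s = b], where the dominating value is a
    maximum. *)
Lemma usc_attains_max (g : R -> R) (a b : R) :
  a <= b ->
  (forall x, a <= x <= b -> forall eps, 0 < eps -> exists delta, 0 < delta /\
     forall y, a <= y <= b -> Rabs (y - x) < delta -> g y < g x + eps) ->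
  exists x, a <= x <= b /\ forall y, a <= y <= b -> g y <= g x.
Proof.
  intros Hab Husc.
  apply NNPP; intro Hno.
  assert (Hgt : forall z, a <= z <= b -> exists y, a <= y <= b /\ g z < g y).
  { intros z Hz. apply NNPP; intro H. apply Hno. exists z. split; [exact Hz|].
    intros y Hy. destruct (Rle_lt_dec (g y) (g z)); [assumption|].
    exfalso; apply H; exists y; split; assumption. }
  set (E := fun x => a <= x <= b /\
              exists z, a <= z <= b /\ forall y, a <= y <= x -> g y <= g z).
  assert (Ea : E a).
  { split; [lra|]. exists a. split; [lra|]. intros y Hy.
    replace y with a by lra. lra. }
  destruct (completeness E) as [s [Hub Hlub]].
  { exists b. intros x [Hx _]. lra. }
  { exists a; exact Ea. }
  assert (Hs : a <= s <= b).
  { split; [apply Hub, Ea|]. apply Hlub. intros x [Hx _]; lra. }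
  destruct (Hgt s Hs) as [z' [Hz' Hgz']].
  destruct (Husc s Hs (g z' - g s)) as [d [Hd Hnear]]; [lra|].
  assert (Hx : exists x, E x /\ s - d < x).
  { apply NNPP; intro H. assert (s <= s - d); [|lra].
    apply Hlub. intros x Ex. destruct (Rle_lt_dec x (s - d)); [assumption|].
    exfalso; apply H; exists x; split; assumption. }
  destruct Hx as [x [[Hx [z [Hz Hxz]]] Hsx]].
  set (t := Rmin (s + d / 2) b).
  assert (Ht : s <= t <= b /\ t <= s + d / 2).
  { unfold t, Rmin. destruct (Rle_dec (s + d / 2) b); lra. }
  assert (Et : exists z, a <= z <= b /\ forall y, a <= y <= t -> g y <= g z).
  { assert (Hc : forall y, a <= y <= t -> g y <= g z \/ g y <= g z').
    { intros y Hy. destruct (Rle_lt_dec y x).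
      - left; apply Hxz; lra.
      - right. assert (g y < g s + (g z' - g s)); [|lra].
        apply Hnear; [lra|]. apply Rabs_def1; lra. }
    destruct (Rle_lt_dec (g z) (g z')).
    - exists z'. split; [assumption|]. intros y Hy. destruct (Hc y Hy); lra.
    - exists z. split; [assumption|]. intros y Hy. destruct (Hc y Hy); lra. }
  assert (E t) as Ett by (split; [lra|exact Et]).
  assert (Hts := Hub t Ett).
  assert (t = b) as Htb.
  { unfold t, Rmin in *. destruct (Rle_dec (s + d / 2) b); lra. }
  destruct Et as [m [Hm Hmax]].
  destruct (Hgt m Hm) as [y [Hy Hlt]].
  assert (g y <= g m) by (apply Hmax; lra). lra.
Qed.

Definition quad (a p X z y : R) : R := a + p * (y - z) + X / 2 * (y - z) ^ 2.

(** Viscosity form of [U'' >= G U' U], tested with exact local parabolas instead of expansions with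
    an error term. [upper_jets_C2] recovers smooth test functions by adding a small curvature. *)
Definition upper_jets (G : R -> R -> R) (U : R -> R) : Prop :=
  forall x p X d, 0 < x -> 0 < d ->
    (forall y, 0 < y -> Rabs (y - x) < d -> U y <= quad (U x) p X x y) ->
    G p (U x) <= X.

Definition bounded_on (U : R -> R) (K : R) : Prop :=
  forall x, 0 <= x -> Rabs (U x) <= K.

Definition lip2 (G : R -> R -> R) (L : R) : Prop :=
  0 <= L /\
  forall p p' u u', Rabs (G p u - G p' u') <= L * (Rabs (p - p') + Rabs (u - u')).

Lemma quad_rebase (a p X z x y : R) :
  quad a p X z y = quad (quad a p X z x) (p + X * (x - z)) X x y.
Proof. unfold quad; field. Qed.

Lemma quad_continuous (a p X z x eps : R) :
  0 < eps -> exists d, 0 < d /\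
    forall y, Rabs (y - x) < d -> Rabs (quad a p X z y - quad a p X z x) < eps.
Proof.
  intros Heps.
  assert (H : continuity_pt (quad a p X z) x).
  { apply derivable_continuous_pt. unfold quad. reg. }
  destruct (H eps Heps) as [d [Hd Hn]].
  exists d; split; [exact Hd|]. intros y Hy.
  destruct (Req_dec y x) as [->|Hne].
  - rewrite Rminus_diag. rewrite Rabs_R0. exact Heps.
  - apply (Hn y). split; [split; [exact I|auto]|exact Hy].
Qed.

(** At an interior positive maximum of [U - quad], a vertical shift of the parabola touches [U] from
    above, which contradicts the strict inequality. That inequality is requested only where [U]
    exceeds the parabola; [sup_upper_jets] exploits this as a lower bound on the function. *)
Lemma quad_barrier (G : R -> R -> R) (U : R -> R) (x1 x2 a p X z : R) :
  usc_on U -> upper_jets G U -> 0 <= x1 -> x1 <= x2 ->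
  U x1 <= quad a p X z x1 -> U x2 <= quad a p X z x2 ->
  (forall y, x1 < y < x2 -> quad a p X z y < U y ->
     X < G (p + X * (y - z)) (U y)) ->
  forall y, x1 <= y <= x2 -> U y <= quad a p X z y.
Proof.
  intros Husc HJ Hx1 Hx12 H1 H2 HG.
  destruct (usc_attains_max (fun y => U y - quad a p X z y) x1 x2 Hx12)
    as [m [Hm Hmax]].
  { intros x Hx eps Heps.
    destruct (Husc x ltac:(lra) (eps / 2) ltac:(lra)) as [d1 [Hd1 N1]].
    destruct (quad_continuous a p X z x (eps / 2) ltac:(lra)) as [d2 [Hd2 N2]].
    exists (Rmin d1 d2). split; [apply Rmin_pos; assumption|].
    intros y Hy Hd.
    assert (A1 := N1 y ltac:(lra) (Rlt_le_trans _ _ _ Hd (Rmin_l _ _))).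
    assert (A2 := N2 y (Rlt_le_trans _ _ _ Hd (Rmin_r _ _))).
    apply Rabs_def2 in A2. lra. }
  intros y Hy. assert (Hym := Hmax y Hy).
  destruct (Rle_lt_dec (U m) (quad a p X z m)) as [Hle|Hgt]; [lra|].
  exfalso.
  assert (m <> x1) by (intro; subst m; lra).
  assert (m <> x2) by (intro; subst m; lra).
  assert (Hm' : x1 < m < x2) by lra.
  assert (X < X); [|lra].
  apply Rlt_le_trans with (1 := HG m Hm' Hgt).
  apply (HJ m (p + X * (m - z)) X (Rmin (m - x1) (x2 - m))).
  - lra.
  - apply Rmin_pos; lra.
  - intros t Ht Hd.
    assert (B1 := Rlt_le_trans _ _ _ Hd (Rmin_l _ _)).
    assert (B2 := Rlt_le_trans _ _ _ Hd (Rmin_r _ _)).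
    apply Rabs_def2 in B1. apply Rabs_def2 in B2.
    assert (C := Hmax t ltac:(lra)).
    rewrite (quad_rebase a p X z m t) in C. unfold quad in *. lra.
Qed.

Lemma lip2_lower (G : R -> R -> R) (L p u : R) :
  lip2 G L -> - (Rabs (G 0 0) + L * Rabs u + L * Rabs p) <= G p u.
Proof.
  intros [HL H]. assert (A := H 0 p 0 u).
  rewrite !Rminus_0_l, !Rabs_Ropp in A.
  assert (B := Rle_abs (G 0 0 - G p u)).
  assert (C := Rle_abs (- G 0 0)). rewrite Rabs_Ropp in C. lra.
Qed.

(** The term [4 * K / rho] lets the barrier of [upper_jets_slope] exceed [U] at distance [rho]; the
    others bound [- G] at slope zero, with room one. *)
Definition slope_bound (G : R -> R -> R) (L K rho : R) : R :=
  Rabs (G 0 0) + L * K + 1 + 4 * K / rho.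

Lemma bounded_on_nonneg (U : R -> R) (K : R) : bounded_on U K -> 0 <= K.
Proof.
  intros H. apply Rle_trans with (2 := H 0 (Rle_refl 0)). apply Rabs_pos.
Qed.

Lemma slope_bound_pos (G : R -> R -> R) (L K rho : R) :
  0 <= L -> 0 <= K -> 0 < rho -> 1 <= slope_bound G L K rho.
Proof.
  intros HL HK Hr. unfold slope_bound.
  assert (A := Rabs_pos (G 0 0)).
  assert (0 <= L * K) by (apply Rmult_le_pos; assumption).
  assert (0 <= 4 * K / rho) by (apply Rdiv_le_0_compat; lra). lra.
Qed.

(** The barrier rises from [x] towards [y] with initial slope [N] and curvature [- k]. Since
    [k * rho <= N], its slopes never exceed [N] in size, hence [- k < G] along it. Going left needs
    the room [rho <= x]; going right does not, so [x = 0] is allowed there. *)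
Lemma upper_jets_slope (G : R -> R -> R) (U : R -> R) (L K rho : R) :
  usc_on U -> upper_jets G U -> bounded_on U K -> lip2 G L ->
  0 < rho -> rho * (L + 1) <= 1 ->
  forall x y, 0 <= x -> 0 <= y -> Rabs (y - x) <= rho -> x <= y \/ rho <= x ->
    U y <= U x + slope_bound G L K rho * Rabs (y - x).
Proof.
  intros Husc HJ HK HG Hr HrL x y Hx Hy Hxy Hside.
  assert (HL := proj1 HG). assert (HK0 := bounded_on_nonneg U K HK).
  assert (HN1 := slope_bound_pos G L K rho HL HK0 Hr).
  set (N := slope_bound G L K rho) in *.
  assert (HNr : 4 * K <= N * rho).
  { unfold N, slope_bound. assert (A := Rabs_pos (G 0 0)).
    assert (0 <= L * K) by (apply Rmult_le_pos; assumption).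
    replace (4 * K) with (4 * K / rho * rho) at 1 by (field; lra).
    apply Rmult_le_compat_r; lra. }
  set (C := Rabs (G 0 0) + L * K).
  assert (HC : 0 <= C <= N - 1).
  { unfold N, slope_bound, C. assert (A := Rabs_pos (G 0 0)).
    assert (0 <= L * K) by (apply Rmult_le_pos; assumption).
    assert (0 <= 4 * K / rho) by (apply Rdiv_le_0_compat; lra). lra. }
  set (k := C + L * N + 1).
  assert (Hk0 : 0 <= L * N) by (apply Rmult_le_pos; lra).
  assert (Hk : k * rho <= N).
  { apply Rle_trans with ((N * (L + 1)) * rho).
    - apply Rmult_le_compat_r; unfold k; lra.
    - replace (N * (L + 1) * rho) with (N * (rho * (L + 1))) by ring.
      replace N with (N * 1) at 2 by ring. apply Rmult_le_compat_l; lra. }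
  assert (Hkr : k * rho * rho <= N * rho) by (apply Rmult_le_compat_r; lra).
  assert (HGl : forall s u, Rabs s <= N -> Rabs u <= K -> - k < G s u).
  { intros s u Hs Hu. assert (A := lip2_lower G L s u HG).
    assert (L * Rabs u <= L * K) by (apply Rmult_le_compat_l; lra).
    assert (L * Rabs s <= L * N) by (apply Rmult_le_compat_l; lra).
    unfold k, C; lra. }
  assert (HUK : forall t, 0 <= t -> - K <= U t <= K).
  { intros t Ht. apply Rabs_le_between, HK, Ht. }
  assert (Hxk := HUK x Hx).
  destruct (Rle_lt_dec x y) as [Hle|Hlt].
  - rewrite (Rabs_pos_eq (y - x)) in * by lra.
    assert (B : U y <= quad (U x) N (- k) x y).
    { apply (quad_barrier G U x (x + rho)); try assumption; try lra.
      - unfold quad; lra.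
      - assert (D := HUK (x + rho) ltac:(lra)).
        unfold quad. replace (x + rho - x) with rho by ring. nra.
      - intros t Ht _. apply HGl; [|apply HK; lra].
        assert (0 <= k * Rabs (t - x) <= k * rho).
        { split; [apply Rmult_le_pos; [unfold k; lra|apply Rabs_pos]|].
          apply Rmult_le_compat_l; [unfold k; lra|]. apply Rabs_le_between; lra. }
        apply Rabs_le_between. rewrite (Rabs_pos_eq (t - x)) in * by lra; split; lra. }
    unfold quad in B. assert (0 <= k) by (unfold k; lra).
    assert (0 <= k * (y - x) ^ 2)
      by (apply Rmult_le_pos; [assumption|apply pow2_ge_0]). lra.
  - assert (Hrx : rho <= x) by lra.
    rewrite (Rabs_left (y - x)) in * by lra.
    assert (B : U y <= quad (U x) (- N) (- k) x y).
    { apply (quad_barrier G U (x - rho) x); try assumption; try lra.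
      - assert (D := HUK (x - rho) ltac:(lra)).
        unfold quad. replace (x - rho - x) with (- rho) by ring. nra.
      - unfold quad; lra.
      - intros t Ht _. apply HGl; [|apply HK; lra].
        assert (0 <= k * Rabs (t - x) <= k * rho).
        { split; [apply Rmult_le_pos; [unfold k; lra|apply Rabs_pos]|].
          apply Rmult_le_compat_l; [unfold k; lra|]. apply Rabs_le_between; lra. }
        apply Rabs_le_between. rewrite (Rabs_left (t - x)) in * by lra; split; lra. }
    unfold quad in B. assert (0 <= k) by (unfold k; lra).
    assert (0 <= k * (y - x) ^ 2)
      by (apply Rmult_le_pos; [assumption|apply pow2_ge_0]). lra.
Qed.

(** A sufficiently concave parabola through two points of the graph is an upper barrier between
    them. Evaluated at the intermediate point [x0], this is the three-point inequality of
    semiconvexity in terms of difference quotients. *)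
Lemma upper_jets_semiconvex (G : R -> R -> R) (U : R -> R) (L K x0 : R) :
  usc_on U -> upper_jets G U -> bounded_on U K -> lip2 G L -> 0 < x0 ->
  exists r k, 0 < r /\ r < x0 /\ 0 <= k /\
    forall a b, 0 < a <= r -> 0 < b <= r ->
      (U x0 - U (x0 - a)) / a - k * a <= (U (x0 + b) - U x0) / b + k * b.
Proof.
  intros Husc HJ HK HG Hx0.
  assert (HL := proj1 HG). assert (HK0 := bounded_on_nonneg U K HK).
  set (rho := Rmin (x0 / 2) (/ (L + 1))).
  assert (Hinv : 0 < / (L + 1)) by (apply Rinv_0_lt_compat; lra).
  assert (Hrho : 0 < rho) by (apply Rmin_pos; lra).
  assert (Hrx : rho <= x0 / 2) by apply Rmin_l.
  assert (HrL : rho * (L + 1) <= 1).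
  { apply Rle_trans with (/ (L + 1) * (L + 1)).
    - apply Rmult_le_compat_r; [lra|apply Rmin_r].
    - rewrite Rinv_l; lra. }
  assert (Hlip := upper_jets_slope G U L K rho Husc HJ HK HG Hrho HrL).
  assert (HN1 := slope_bound_pos G L K rho HL HK0 Hrho).
  set (N := slope_bound G L K rho) in *.
  set (C := Rabs (G 0 0) + L * K + L * N).
  assert (HC : 0 <= C).
  { unfold C. assert (A := Rabs_pos (G 0 0)).
    assert (0 <= L * K) by (apply Rmult_le_pos; assumption).
    assert (0 <= L * N) by (apply Rmult_le_pos; lra). lra. }
  (* The barrier slopes stay within [N + k / 2 * rho], and [L * rho <= 1], so [G >= - (C + k / 2)]
     along it; this beats [- k] as soon as [k > 2 * C]. *)
  set (k := 2 * C + 1).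
  exists (rho / 2), (k / 2). split; [lra|]. split; [lra|]. split; [unfold k; lra|].
  intros a b Ha Hb.
  set (x1 := x0 - a). set (x2 := x0 + b).
  set (s := (U x2 - U x1) / (a + b)).
  assert (Hs : Rabs s <= N).
  { assert (A1 := Hlip x1 x2 ltac:(unfold x1; lra) ltac:(unfold x2; lra)).
    assert (A2 := Hlip x2 x1 ltac:(unfold x2; lra) ltac:(unfold x1; lra)).
    rewrite (Rabs_pos_eq (x2 - x1)) in A1 by (unfold x1, x2; lra).
    rewrite (Rabs_left (x1 - x2)) in A2 by (unfold x1, x2; lra).
    specialize (A1 ltac:(unfold x1, x2; lra) ltac:(unfold x1, x2; lra)).
    specialize (A2 ltac:(unfold x1, x2; lra) ltac:(unfold x1, x2; lra)).
    replace (x2 - x1) with (a + b) in A1 by (unfold x1, x2; ring).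
    replace (- (x1 - x2)) with (a + b) in A2 by (unfold x1, x2; ring).
    unfold s. apply Rabs_le_between. split.
    - apply Rle_div_r; lra.
    - apply Rle_div_l; lra. }
  (* the parabola of curvature [-k] through the two end points *)
  assert (B : U x0 <= quad (U x1) (s + k / 2 * (a + b)) (- k) x1 x0).
  { apply (quad_barrier G U x1 x2); try assumption; try (unfold x1, x2; lra).
    - unfold quad; lra.
    - unfold quad. replace (x2 - x1) with (a + b) by (unfold x1, x2; ring).
      unfold s. apply Req_le. field. lra.
    - intros y Hy _.
      assert (A := lip2_lower G L (s + k / 2 * (a + b) + - k * (y - x1)) (U y) HG).
      assert (HUy := HK y ltac:(unfold x1 in *; lra)).
      assert (L * Rabs (U y) <= L * K) by (apply Rmult_le_compat_l; lra).
      assert (Hk0 : 0 <= k) by (unfold k; lra).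
      assert (Hsl : Rabs (s + k / 2 * (a + b) + - k * (y - x1)) <= N + k / 2 * rho).
      { apply Rle_trans with (Rabs s + Rabs (k / 2 * (a + b) + - k * (y - x1))).
        - rewrite Rplus_assoc. apply Rabs_triang.
        - apply Rplus_le_compat; [exact Hs|]. apply Rabs_le_between.
          assert (0 <= k * (y - x1) <= k * (a + b)).
          { split; [apply Rmult_le_pos; lra|].
            apply Rmult_le_compat_l; unfold x1, x2 in *; lra. }
          assert (k * (a + b) <= k * rho) by (apply Rmult_le_compat_l; lra).
          split; lra. }
      assert (L * Rabs (s + k / 2 * (a + b) + - k * (y - x1)) <= L * (N + k / 2 * rho))
        by (apply Rmult_le_compat_l; lra).
      assert (L * rho <= 1) by lra.
      assert (L * rho * k <= 1 * k) by (apply Rmult_le_compat_r; lra).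
      unfold C in k. unfold k in *. nra. }
  unfold quad in B. replace (x0 - x1) with a in B by (unfold x1; ring).
  apply Rmult_le_reg_r with (a * b); [apply Rmult_lt_0_compat; lra|].
  fold x1 x2.
  replace (((U x0 - U x1) / a - k / 2 * a) * (a * b))
    with (U x0 * b - U x1 * b - k / 2 * a * a * b) by (field; lra).
  replace (((U x2 - U x0) / b + k / 2 * b) * (a * b))
    with (U x2 * a - U x0 * a + k / 2 * b * b * a) by (field; lra).
  apply Rmult_le_compat_r with (r := a + b) in B; [|lra].
  replace ((U x1 + (s + k / 2 * (a + b)) * a + - k / 2 * a ^ 2) * (a + b))
    with (U x1 * b + U x2 * a + k / 2 * a * b * (a + b)) in B
    by (unfold s; field; lra).
  lra.
Qed.

(** Semiconvexity puts every corrected left difference quotient below every corrected right one; the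
    supremum of the left ones separates them and serves as the slope of a supporting parabola. *)
Lemma upper_jets_support (G : R -> R -> R) (U : R -> R) (L K x0 : R) :
  usc_on U -> upper_jets G U -> bounded_on U K -> lip2 G L -> 0 < x0 ->
  exists s k r, 0 < r /\ r < x0 /\ 0 <= k /\
    forall y, Rabs (y - x0) <= r -> quad (U x0) s (- k) x0 y <= U y.
Proof.
  intros Husc HJ HK HG Hx0.
  destruct (upper_jets_semiconvex G U L K x0 Husc HJ HK HG Hx0)
    as (r & k & Hr & Hrx & Hk & H).
  set (E := fun t => exists a, 0 < a <= r /\ t = (U x0 - U (x0 - a)) / a - k * a).
  destruct (completeness E) as [s [Hub Hlub]].
  { exists ((U (x0 + r) - U x0) / r + k * r). intros t (a & Ha & ->). apply H; lra. }
  { exists ((U x0 - U (x0 - r)) / r - k * r). exists r. split; [lra|reflexivity]. }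
  (* The factor 2 compensates the halved curvature in [quad]. *)
  exists s, (2 * k), r. split; [lra|]. split; [lra|]. split; [lra|].
  intros y Hy. apply Rabs_le_between in Hy.
  unfold quad.
  destruct (Rtotal_order y x0) as [Hlt|[->|Hgt]].
  - set (a := x0 - y).
    assert (A : (U x0 - U (x0 - a)) / a - k * a <= s)
      by (apply Hub; exists a; split; [unfold a; lra|reflexivity]).
    replace (x0 - a) with y in A by (unfold a; ring).
    apply Rmult_le_compat_r with (r := a) in A; [|unfold a; lra].
    replace (((U x0 - U y) / a - k * a) * a) with (U x0 - U y - k * a * a) in A
      by (field; unfold a; lra).
    unfold a in A. nra.
  - rewrite Rminus_diag. lra.
  - set (b := y - x0).
    assert (A : s <= (U (x0 + b) - U x0) / b + k * b).
    { apply Hlub. intros t (a & Ha & ->). apply H; unfold b; lra. }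
    replace (x0 + b) with y in A by (unfold b; ring).
    apply Rmult_le_compat_r with (r := b) in A; [|unfold b; lra].
    replace (((U y - U x0) / b + k * b) * b) with (U y - U x0 + k * b * b) in A
      by (field; unfold b; lra).
    unfold b in *. lra.
Qed.

(** * Comparison *)

(** If [U x2] were below the claimed parabola, the parabola of curvature [alpha] through the graph
    at [x0] and [x2] would have a slope [s' < s] at [x0]. It is an upper barrier because [alpha < G]
    nearby, but just to the right of [x0] the supporting parabola of slope [s] is above it. *)
Lemma upper_jets_expansion (G : R -> R -> R) (U : R -> R) (L x0 s k r alpha : R) :
  usc_on U -> upper_jets G U -> lip2 G L -> 0 < x0 -> 0 < r -> 0 <= k ->
  (forall y, Rabs (y - x0) <= r -> quad (U x0) s (- k) x0 y <= U y) ->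
  alpha < G s (U x0) ->
  exists r', 0 < r' /\
    forall y, x0 < y <= x0 + r' -> quad (U x0) s alpha x0 y <= U y.
Proof.
  intros Husc HJ HG Hx0 Hr Hk Hsup Hal.
  assert (HL := proj1 HG).
  set (gap := G s (U x0) - alpha).
  (* Errors of size [tau] in both arguments of [G] change it by less than [gap]. *)
  set (tau := gap / (4 * (L + 1))).
  assert (Hgap : 0 < gap) by (unfold gap; lra).
  assert (Htau : 0 < tau) by (apply Rdiv_lt_0_compat; lra).
  assert (HLt : L * (2 * tau) < gap).
  { replace gap with (4 * (L + 1) * tau) by (unfold tau; field; lra). nra. }
  destruct (Husc x0 ltac:(lra) tau Htau) as [d [Hd Hnear]].
  set (D := Rabs s + k + 2 * Rabs alpha + 1).
  assert (As := Rabs_pos s). assert (Aa := Rabs_pos alpha).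
  assert (HD : 1 <= D) by (unfold D; lra).
  (* The bounds ensure in turn the support from below, the semicontinuity from above, squares
     smaller than lengths, and a variation at most [tau] for the supporting parabola and for the
     barrier slopes. *)
  set (r' := Rmin (Rmin r (d / 2)) (Rmin 1 (tau / D))).
  assert (Hr'0 : 0 < r').
  { unfold r'. repeat apply Rmin_pos; try lra. apply Rdiv_lt_0_compat; lra. }
  assert (H1 : r' <= r) by (unfold r'; eapply Rle_trans; [apply Rmin_l|apply Rmin_l]).
  assert (H2 : r' <= d / 2) by (unfold r'; eapply Rle_trans; [apply Rmin_l|apply Rmin_r]).
  assert (H3 : r' <= 1) by (unfold r'; eapply Rle_trans; [apply Rmin_r|apply Rmin_l]).
  assert (H4 : D * r' <= tau).
  { apply Rle_trans with (D * (tau / D)).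
    - apply Rmult_le_compat_l; [lra|].
      unfold r'; eapply Rle_trans; [apply Rmin_r|apply Rmin_r].
    - apply Req_le; field; lra. }
  exists r'. split; [exact Hr'0|].
  intros x2 Hx2. apply Rnot_lt_le. intro Hlt.
  set (h := x2 - x0). assert (Hh : 0 < h <= r') by (unfold h; lra).
  assert (HDh : D * h <= tau) by nra.
  set (s' := (U x2 - U x0) / h - alpha / 2 * h).
  assert (E2 : U x2 = quad (U x0) s' alpha x0 x2).
  { unfold quad. fold h. unfold s'. field. lra. }
  assert (Hs1 : s' < s).
  { rewrite E2 in Hlt. unfold quad in Hlt. fold h in Hlt. nra. }
  assert (Hs2 : s - (k + Rabs alpha) / 2 * h <= s').
  { assert (A := Hsup x2 ltac:(rewrite Rabs_pos_eq; fold h; lra)).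
    rewrite E2 in A. unfold quad in A. fold h in A.
    assert (alpha <= Rabs alpha) by apply Rle_abs. nra. }
  assert (HB : forall y, x0 <= y <= x2 -> U y <= quad (U x0) s' alpha x0 y).
  { apply (quad_barrier G U); try assumption; try lra.
    - unfold quad. rewrite Rminus_diag. lra.
    - intros y Hy _.
      assert (Hyh : 0 <= y - x0 <= h) by (unfold h; lra).
      assert (A1 : Rabs (U y - U x0) <= tau).
      { apply Rabs_le_between. split.
        - assert (A := Hsup y ltac:(rewrite Rabs_pos_eq; lra)).
          unfold quad in A.
          assert (- Rabs s <= s) by (assert (Z := Rle_abs (- s)); rewrite Rabs_Ropp in Z; lra).
          assert (- Rabs s * h <= s * (y - x0)) by nra.
          assert (y - x0 <= 1) by lra.
          assert ((y - x0) ^ 2 <= h) by nra.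
          assert (k * (y - x0) ^ 2 <= k * h) by (apply Rmult_le_compat_l; lra).
          unfold D in HDh. nra.
        - assert (A := Hnear y ltac:(lra) ltac:(rewrite Rabs_pos_eq; lra)). lra. }
      assert (A2 : Rabs (s' + alpha * (y - x0) - s) <= tau).
      { assert (- Rabs alpha <= alpha <= Rabs alpha)
          by (apply Rabs_le_between, Rle_refl).
        assert (- (Rabs alpha * h) <= alpha * (y - x0) <= Rabs alpha * h)
          by (split; nra).
        unfold D in HDh. apply Rabs_le_between. split; nra. }
      assert (A3 := proj2 HG s (s' + alpha * (y - x0)) (U x0) (U y)).
      rewrite (Rabs_minus_sym s), (Rabs_minus_sym (U x0)) in A3.
      assert (A4 := Rle_abs (G s (U x0) - G (s' + alpha * (y - x0)) (U y))).
      assert (L * (Rabs (s' + alpha * (y - x0) - s) + Rabs (U y - U x0)) <= L * (2 * tau))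
        by (apply Rmult_le_compat_l; lra).
      unfold gap in *. lra. }
  (* At [x0 + t] support and barrier together give [(s - s') * t <= (k + alpha) / 2 * t ^ 2], which
     fails for a [t] this small. *)
  set (t := Rmin h ((s - s') / (k + Rabs alpha + 1))).
  assert (Ht0 : 0 < t) by (apply Rmin_pos; [lra|apply Rdiv_lt_0_compat; lra]).
  assert (Hth : t <= h) by apply Rmin_l.
  assert (Ht : (k + Rabs alpha + 1) * t <= s - s').
  { apply Rle_trans with ((k + Rabs alpha + 1) * ((s - s') / (k + Rabs alpha + 1))).
    - apply Rmult_le_compat_l; [lra|apply Rmin_r].
    - apply Req_le; field; lra. }
  assert (B1 := HB (x0 + t) ltac:(unfold h in *; lra)).
  assert (B2 := Hsup (x0 + t)
    ltac:(replace (x0 + t - x0) with t by ring; rewrite Rabs_pos_eq; lra)).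
  unfold quad in B1, B2. replace (x0 + t - x0) with t in * by ring.
  assert (B : (s - s') * t <= (k + alpha) / 2 * t * t) by nra.
  assert (s - s' <= (k + alpha) / 2 * t).
  { apply Rmult_le_reg_r with t; lra. }
  assert (alpha <= Rabs alpha) by apply Rle_abs. nra.
Qed.

Lemma quadratic_dominates_linear (e k r : R) :
  0 < r -> 0 <= k ->
  (forall h, Rabs h <= r -> e * h <= k * h ^ 2) -> e = 0.
Proof.
  intros Hr Hk H.
  set (t := Rmin r (Rabs e / (2 * (k + 1)))).
  destruct (Req_dec e 0) as [|Hne]; [assumption|exfalso].
  assert (He := Rabs_pos_lt e Hne).
  assert (Ht : 0 < t) by (apply Rmin_pos; [lra|apply Rdiv_lt_0_compat; lra]).
  assert (Htr : t <= r) by apply Rmin_l.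
  assert (Hte : 2 * (k + 1) * t <= Rabs e).
  { apply Rle_trans with (2 * (k + 1) * (Rabs e / (2 * (k + 1)))).
    - apply Rmult_le_compat_l; [lra|apply Rmin_r].
    - apply Req_le; field; lra. }
  destruct (Rle_lt_dec 0 e) as [Hp|Hn].
  - rewrite Rabs_pos_eq in Hte by lra.
    assert (A := H t ltac:(rewrite Rabs_pos_eq; lra)). nra.
  - rewrite Rabs_left in Hte by lra.
    assert (A := H (- t) ltac:(rewrite Rabs_Ropp, Rabs_pos_eq; lra)). nra.
Qed.

(* [U1] plays the subsolution and [U2] the opposite of the supersolution, so that
   both satisfy one-sided conditions of the same kind. *)
Lemma upper_jets_comparison (G1 G2 : R -> R -> R) (U1 U2 : R -> R)
    (L K k Lf : R) :
  usc_on U1 -> upper_jets G1 U1 -> bounded_on U1 K -> lip2 G1 L ->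
  usc_on U2 -> upper_jets G2 U2 -> bounded_on U2 K -> lip2 G2 L ->
  U1 0 + U2 0 <= 0 -> 0 < k -> 0 <= Lf ->
  (forall p delta u u', 0 <= delta ->
     k * (u + u') - Lf * delta <= G1 p u + G2 (delta - p) u') ->
  forall x, 0 <= x -> U1 x + U2 x <= 0.
Proof.
  intros Husc1 HJ1 HK1 HG1 Husc2 HJ2 HK2 HG2 H0 Hk HLf Hsum x1 Hx1.
  apply Rnot_lt_le. intro Hm.
  assert (HK0 := bounded_on_nonneg U1 K HK1).
  assert (HU1 : forall t, 0 <= t -> - K <= U1 t <= K)
    by (intros t Ht; apply Rabs_le_between, HK1, Ht).
  assert (HU2 : forall t, 0 <= t -> - K <= U2 t <= K)
    by (intros t Ht; apply Rabs_le_between, HK2, Ht).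
  set (m := U1 x1 + U2 x1) in *.
  assert (Hx1p : 0 < x1).
  { destruct (Rle_lt_or_eq_dec 0 x1 Hx1) as [|He]; [assumption|].
    exfalso. unfold m in Hm. rewrite <- He in Hm. lra. }
  (* The first bound leaves at least [m / 2] of the penalised sum at [x1]; the second keeps the cost
     [Lf * delta] of the penalty below [k * m / 4]. *)
  set (delta := Rmin (m / (2 * x1)) (k * m / (4 * (Lf + 1)))).
  assert (Hkm : 0 < k * m) by (apply Rmult_lt_0_compat; lra).
  assert (Hde : 0 < delta) by (apply Rmin_pos; apply Rdiv_lt_0_compat; lra).
  assert (Hd1 : delta * x1 <= m / 2).
  { apply Rle_trans with (m / (2 * x1) * x1).
    - apply Rmult_le_compat_r; [lra|apply Rmin_l].
    - apply Req_le; field; lra. }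
  assert (Hd2 : Lf * delta <= k * m / 4).
  { apply Rle_trans with ((Lf + 1) * (k * m / (4 * (Lf + 1)))).
    - apply Rmult_le_compat; [lra|lra|lra|apply Rmin_r].
    - apply Req_le; field; lra. }
  (* Beyond [Rm] the penalty exceeds [2 * K], so the penalised sum is nonpositive and the maximum
     over [[0, Rm]] is global. *)
  set (Rm := x1 + 2 * K / delta).
  assert (HRm : x1 <= Rm).
  { unfold Rm. assert (0 <= 2 * K / delta) by (apply Rdiv_le_0_compat; lra). lra. }
  destruct (usc_attains_max (fun y => U1 y + U2 y - delta * y) 0 Rm) as [x0 [Hx0 Hmax]].
  { lra. }
  { intros x Hx eps Heps.
    destruct (Husc1 x ltac:(lra) (eps / 3) ltac:(lra)) as [d1 [Hd1' N1]].
    destruct (Husc2 x ltac:(lra) (eps / 3) ltac:(lra)) as [d2 [Hd2' N2]].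
    exists (Rmin (Rmin d1 d2) (eps / (3 * delta))). split.
    { repeat apply Rmin_pos; try assumption. apply Rdiv_lt_0_compat; lra. }
    intros y Hy Hd.
    assert (A := Rlt_le_trans _ _ _ Hd (Rmin_l _ _)).
    assert (A3 := Rlt_le_trans _ _ _ Hd (Rmin_r _ _)).
    assert (A1 := N1 y ltac:(lra) (Rlt_le_trans _ _ _ A (Rmin_l _ _))).
    assert (A2 := N2 y ltac:(lra) (Rlt_le_trans _ _ _ A (Rmin_r _ _))).
    apply Rmult_lt_compat_l with (r := delta) in A3; [|lra].
    replace (delta * (eps / (3 * delta))) with (eps / 3) in A3 by (field; lra).
    assert (- (y - x) <= Rabs (y - x)) by (rewrite <- Rabs_Ropp; apply Rle_abs).
    nra. }
  assert (Hgm : m / 2 <= U1 x0 + U2 x0 - delta * x0).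
  { assert (A := Hmax x1 ltac:(lra)). fold m in A. lra. }
  assert (Hx0p : 0 < x0).
  { destruct (Rle_lt_or_eq_dec 0 x0 (proj1 Hx0)) as [|He]; [assumption|].
    exfalso. rewrite <- He in Hgm. lra. }
  assert (Hglob : forall y, 0 <= y ->
    U1 y + U2 y - delta * y <= U1 x0 + U2 x0 - delta * x0).
  { intros y Hy. destruct (Rle_lt_dec y Rm) as [|Hgt]; [apply Hmax; lra|].
    assert (A1 := HU1 y Hy). assert (A2 := HU2 y Hy).
    assert (2 * K <= delta * y); [|lra].
    replace (2 * K) with (delta * (2 * K / delta)) by (field; lra).
    apply Rmult_le_compat_l; unfold Rm in Hgt; lra. }
  destruct (upper_jets_support G1 U1 L K x0 Husc1 HJ1 HK1 HG1 Hx0p)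
    as (s & k1 & r1 & Hr1 & Hr1x & Hk1 & S1).
  destruct (upper_jets_support G2 U2 L K x0 Husc2 HJ2 HK2 HG2 Hx0p)
    as (t & k2 & r2 & Hr2 & Hr2x & Hk2 & S2).
  (* The two supporting parabolas minus the penalty lie below the maximal value and meet it at [x0],
     so their linear part vanishes. *)
  assert (Hst : s + t - delta = 0).
  { apply (quadratic_dominates_linear _ ((k1 + k2) / 2) (Rmin r1 r2));
      [apply Rmin_pos; lra|lra|].
    intros h Hh.
    assert (h1 := Rle_trans _ _ _ Hh (Rmin_l _ _)).
    assert (h2 := Rle_trans _ _ _ Hh (Rmin_r _ _)).
    replace h with (x0 + h - x0) in h1 by ring.
    replace h with (x0 + h - x0) in h2 by ring.
    assert (A1 := S1 (x0 + h) h1). assert (A2 := S2 (x0 + h) h2).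
    apply Rabs_le_between in h1.
    assert (A := Hglob (x0 + h) ltac:(lra)).
    unfold quad in A1, A2. replace (x0 + h - x0) with h in * by ring. nra. }
  assert (Ht : t = delta - s) by lra. subst t.
  assert (Hg := Hsum s delta (U1 x0) (U2 x0) ltac:(lra)).
  assert (Hkk : k * m / 2 <= k * (U1 x0 + U2 x0)).
  { replace (k * m / 2) with (k * (m / 2)) by field.
    apply Rmult_le_compat_l; [lra|].
    assert (0 <= delta * x0) by (apply Rmult_le_pos; lra). lra. }
  set (gap := k * m / 4) in *.
  assert (Hgap : 0 < gap) by (unfold gap; lra).
  (* Each curvature gives up [gap / 4]. As the two [G] values sum to at least [gap], the total
     curvature is at least [gap / 2]; the slopes cancel against the penalty, so a step [h] to the
     right increases the penalised sum. *)
  destruct (upper_jets_expansion G1 U1 L x0 s k1 r1 (G1 s (U1 x0) - gap / 4)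
    Husc1 HJ1 HG1 Hx0p Hr1 Hk1 S1 ltac:(lra)) as [q1 [Hq1 E1]].
  destruct (upper_jets_expansion G2 U2 L x0 (delta - s) k2 r2
    (G2 (delta - s) (U2 x0) - gap / 4)
    Husc2 HJ2 HG2 Hx0p Hr2 Hk2 S2 ltac:(lra)) as [q2 [Hq2 E2]].
  set (h := Rmin q1 q2). assert (Hh : 0 < h) by (apply Rmin_pos; lra).
  assert (h <= q1) by apply Rmin_l. assert (h <= q2) by apply Rmin_r.
  assert (A1 := E1 (x0 + h) ltac:(lra)). assert (A2 := E2 (x0 + h) ltac:(lra)).
  assert (A := Hglob (x0 + h) ltac:(lra)).
  unfold quad in A1, A2. replace (x0 + h - x0) with h in * by ring.
  assert (0 < h ^ 2) by (apply pow_lt; exact Hh).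
  assert (0 < gap / 2 * h ^ 2) by (apply Rmult_lt_0_compat; lra).
  set (g1 := G1 s (U1 x0)) in *. set (g2 := G2 (delta - s) (U2 x0)) in *.
  assert (gap <= g1 + g2) by (unfold gap in *; lra).
  assert (gap * h ^ 2 <= (g1 + g2) * h ^ 2) by (apply Rmult_le_compat_r; lra).
  lra.
Qed.

(** * The Hamiltonian and viscosity inequalities as jet inequalities *)

(** The mean of [exp (s * t)] over [s] in [[0, 1]]; the value 1 fills the removable singularity. *)
Definition expm1_div (t : R) : R :=
  if Req_EM_T t 0 then 1 else (exp t - 1) / t.

(** Convexity of [exp] between 0 and [t]: the tangent line at [w * t] lies below the graph at both
    end points, and the two inequalities are averaged. *)
Lemma exp_chord (t w : R) : 0 <= w <= 1 -> exp (w * t) <= w * exp t + (1 - w).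
Proof.
  intros Hw. set (s := w * t).
  assert (A1 : exp s * (1 + (t - s)) <= exp t).
  { replace (exp t) with (exp s * exp (t - s)) by (rewrite <- exp_plus; f_equal; ring).
    apply Rmult_le_compat_l; [left; apply exp_pos|apply exp_ineq1_le]. }
  assert (A2 : exp s * (1 - s) <= 1).
  { apply Rle_trans with (exp s * exp (- s)).
    - apply Rmult_le_compat_l; [left; apply exp_pos|apply exp_ineq1_le].
    - rewrite <- exp_plus, Rplus_opp_r, exp_0. lra. }
  apply Rmult_le_compat_l with (r := w) in A1; [|lra].
  apply Rmult_le_compat_l with (r := 1 - w) in A2; [|lra].
  assert (w * (exp s * (1 + (t - s))) + (1 - w) * (exp s * (1 - s)) = exp s).
  { unfold s at 2 4. ring. }
  lra.
Qed.

Lemma expm1_div_ge1 (t : R) : 0 <= t -> 1 <= expm1_div t.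
Proof.
  intros Ht. unfold expm1_div. destruct (Req_EM_T t 0); [lra|].
  apply Rle_div_r; [lra|]. assert (A := exp_ineq1_le t). lra.
Qed.

Lemma expm1_div_le1 (t : R) : t <= 0 -> expm1_div t <= 1.
Proof.
  intros Ht. unfold expm1_div. destruct (Req_EM_T t 0); [lra|].
  replace ((exp t - 1) / t) with ((1 - exp t) / (- t)) by (field; repeat split; lra).
  apply Rle_div_l; [lra|]. assert (A := exp_ineq1_le t). lra.
Qed.

(** These are slopes of chords of [exp] issued from 0. Opposite signs are separated by the value 1;
    equal signs reduce to [exp_chord]. *)
Lemma expm1_div_incr (s t : R) : s <= t -> expm1_div s <= expm1_div t.
Proof.
  intros Hst.
  destruct (Rle_lt_dec s 0) as [Hs|Hs]; [destruct (Rle_lt_dec 0 t) as [Ht|Ht]|].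
  - apply Rle_trans with 1; [apply expm1_div_le1|apply expm1_div_ge1]; assumption.
  - unfold expm1_div. destruct (Req_EM_T s 0); [lra|]. destruct (Req_EM_T t 0); [lra|].
    assert (Hw : 0 <= t / s <= 1).
    { replace (t / s) with (- t / - s) by (field; repeat split; lra).
      split; [apply Rdiv_le_0_compat; lra|apply Rle_div_l; lra]. }
    assert (A := exp_chord s (t / s) Hw).
    replace (t / s * s) with t in A by (field; repeat split; lra).
    replace ((exp t - 1) / t) with ((1 - exp t) / (- t)) by (field; repeat split; lra).
    apply (Rle_div_r _ _ (- t)); [lra|].
    replace ((exp s - 1) / s * - t) with (- (t / s * exp s) + t / s)
      by (field; lra).
    lra.
  - unfold expm1_div. destruct (Req_EM_T s 0); [lra|]. destruct (Req_EM_T t 0); [lra|].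
    assert (Hw : 0 <= s / t <= 1).
    { split; [apply Rdiv_le_0_compat; lra|apply Rle_div_l; lra]. }
    assert (A := exp_chord t (s / t) Hw).
    replace (s / t * t) with s in A by (field; repeat split; lra).
    apply (Rle_div_l _ _ s); [lra|].
    replace ((exp t - 1) / t * s) with (s / t * exp t - s / t) by (field; lra).
    lra.
Qed.

Lemma expm1_div_opp (t : R) : expm1_div (- t) = exp (- t) * expm1_div t.
Proof.
  unfold expm1_div. destruct (Req_EM_T t 0) as [->|Ht].
  - rewrite Ropp_0, exp_0. destruct (Req_EM_T 0 0); lra.
  - destruct (Req_EM_T (- t) 0); [lra|].
    rewrite exp_Ropp. assert (A := exp_pos t). field. lra.
Qed.

Lemma expm1_div_pos (t : R) : 0 < expm1_div t.
Proof.
  destruct (Rle_lt_dec 0 t) as [Ht|Ht].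
  - assert (A := expm1_div_ge1 t Ht). lra.
  - assert (A := expm1_div_ge1 (- t) ltac:(lra)).
    rewrite expm1_div_opp in A.
    apply Rmult_lt_reg_l with (exp (- t)); [apply exp_pos|]. lra.
Qed.

(** The lower bound is monotonicity. For the upper one, [expm1_div_opp] identifies
    [exp (- t) * expm1_div t] with [expm1_div (- t)], which decreases in [t], so the logarithm grows
    with slope at most 1. *)
Lemma ln_expm1_div_incr (s t : R) :
  s <= t -> 0 <= ln (expm1_div t) - ln (expm1_div s) <= t - s.
Proof.
  intros Hst. assert (Ps := expm1_div_pos s). assert (Pt := expm1_div_pos t).
  assert (A := expm1_div_incr s t Hst).
  assert (B := expm1_div_incr (- t) (- s) ltac:(lra)).
  rewrite !expm1_div_opp in B.
  assert (C : expm1_div t <= exp (t - s) * expm1_div s).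
  { apply Rmult_le_reg_l with (exp (- t)); [apply exp_pos|].
    rewrite <- Rmult_assoc, <- exp_plus.
    replace (- t + (t - s)) with (- s) by ring. exact B. }
  assert (L1 := ln_le _ _ Ps A). assert (L2 := ln_le _ _ Pt C).
  rewrite ln_mult, ln_exp in L2; [lra|apply exp_pos|assumption].
Qed.

(** The argument of the logarithm is [a] times [expm1_div], which absorbs the separate case
    [z = 1]. *)
Lemma fH_expm1_div (mu a lambda z : R) : 0 < a -> 0 < lambda ->
  fH mu a lambda z
  = mu * z + lambda * (ln a + ln (expm1_div (a / lambda * (1 - z)))).
Proof.
  intros Ha Hl. rewrite <- ln_mult; [|assumption|apply expm1_div_pos].
  unfold fH, expm1_div.
  assert (Hal : a / lambda <> 0)
    by (apply Rgt_not_eq, Rdiv_lt_0_compat; assumption).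
  destruct (Req_EM_T z 1) as [->|Hz].
  - replace (a / lambda * (1 - 1)) with 0 by ring.
    destruct (Req_EM_T 0 0); [|lra]. rewrite !Rmult_1_r. reflexivity.
  - destruct (Req_EM_T (a / lambda * (1 - z)) 0) as [E|_].
    + exfalso. apply Rmult_integral in E. lra.
    + do 3 f_equal. field. repeat split; lra.
Qed.

Definition lipschitz (f : R -> R) (L : R) : Prop :=
  0 <= L /\ forall x y, Rabs (f x - f y) <= L * Rabs (x - y).

(** The logarithm of [expm1_div] is 1-Lipschitz, and the inner slope [a / lambda] times the outer
    factor [lambda] is [a]. *)
Lemma fH_lipschitz (mu a lambda : R) : 0 < a -> 0 < lambda ->
  lipschitz (fH mu a lambda) (Rabs mu + a).
Proof.
  intros Ha Hl. assert (Am := Rabs_pos mu). split; [lra|].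
  assert (H : forall x y, x <= y ->
    Rabs (fH mu a lambda x - fH mu a lambda y) <= (Rabs mu + a) * Rabs (x - y)).
  { intros x y Hxy. rewrite !fH_expm1_div by assumption.
    assert (Hk : 0 < a / lambda) by (apply Rdiv_lt_0_compat; assumption).
    assert (B := ln_expm1_div_incr (a / lambda * (1 - y)) (a / lambda * (1 - x))
      ltac:(apply Rmult_le_compat_l; lra)).
    set (l1 := ln (expm1_div (a / lambda * (1 - x)))) in *.
    set (l2 := ln (expm1_div (a / lambda * (1 - y)))) in *.
    replace (mu * x + lambda * (ln a + l1) - (mu * y + lambda * (ln a + l2)))
      with (mu * (x - y) + lambda * (l1 - l2)) by ring.
    eapply Rle_trans; [apply Rabs_triang|]. rewrite Rmult_plus_distr_r.
    apply Rplus_le_compat; [rewrite Rabs_mult; lra|].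
    rewrite Rabs_mult, (Rabs_pos_eq lambda), (Rabs_pos_eq (l1 - l2)) by lra.
    rewrite (Rabs_minus_sym x y), (Rabs_pos_eq (y - x)) by lra.
    apply Rle_trans with (lambda * (a / lambda * (1 - x) - a / lambda * (1 - y))).
    - apply Rmult_le_compat_l; lra.
    - apply Req_le; field; lra. }
  intros x y. destruct (Rle_lt_dec x y) as [|Hlt]; [apply H; assumption|].
  rewrite (Rabs_minus_sym (fH _ _ _ x)), (Rabs_minus_sym x). apply H; lra.
Qed.

(** Differentiability of [Derive phi] at [x] bounds the derivative of the remainder by
    [eps * Rabs (z - x)]; the mean value theorem supplies the second factor. *)
Lemma C2_taylor (phi : R -> R) (x eps : R) : C2 phi -> 0 < eps ->
  exists d, 0 < d /\ forall y, Rabs (y - x) < d ->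
    Rabs (phi y - quad (phi x) (Derive phi x) (Derive (Derive phi) x) x y)
      <= eps * (y - x) ^ 2.
Proof.
  intros (D1 & D2 & _) Heps.
  assert (H2 := proj1 (is_derive_Reals _ _ _) (Derive_correct _ _ (D2 x))).
  destruct (H2 eps Heps) as [[d Hd] Hlim]. simpl in Hlim.
  exists d. split; [exact Hd|]. intros y Hy.
  set (p := Derive phi x) in *. set (X := Derive (Derive phi) x) in *.
  set (g := fun t => phi t - quad (phi x) p X x t).
  set (dg := fun t => Derive phi t - (p + X * (t - x))).
  assert (Hg : forall t, is_derive g t (dg t)).
  { intros t. unfold g, dg. apply @is_derive_minus.
    - apply Derive_correct, D1.
    - unfold quad. auto_derive; [exact I|]. field. }
  destruct (MVT_gen g x y dg) as [z [Hz Hmvt]].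
  - intros t _. apply Hg.
  - intros t _. apply derivable_continuous_pt.
    exists (dg t). apply is_derive_Reals, Hg.
  - assert (Hgx : g x = 0) by (unfold g, quad; ring).
    rewrite Hgx, Rminus_0_r in Hmvt.
    change (Rabs (g y) <= eps * (y - x) ^ 2). rewrite Hmvt, Rabs_mult.
    assert (Hzx : Rabs (z - x) <= Rabs (y - x)).
    { unfold Rmin, Rmax in Hz. destruct (Rle_dec x y).
      - rewrite !Rabs_pos_eq; lra.
      - rewrite !Rabs_left1; lra. }
    assert (Hdg : Rabs (dg z) <= eps * Rabs (z - x)).
    { destruct (Req_dec z x) as [->|Hne].
      - unfold dg. fold p. rewrite !Rminus_diag.
        replace (p - (p + X * 0)) with 0 by ring. rewrite Rabs_R0; lra.
      - assert (A := Hlim (z - x) ltac:(lra) ltac:(lra)).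
        replace (x + (z - x)) with z in A by ring. fold p in A.
        replace (dg z) with (((Derive phi z - p) / (z - x) - X) * (z - x))
          by (unfold dg; field; repeat split; lra).
        rewrite Rabs_mult. apply Rmult_le_compat_r; [apply Rabs_pos|lra]. }
    apply Rle_trans with (eps * Rabs (y - x) * Rabs (y - x)).
    + apply Rmult_le_compat_r; [apply Rabs_pos|].
      apply Rle_trans with (1 := Hdg). apply Rmult_le_compat_l; lra.
    + apply Req_le. rewrite Rmult_assoc, <- Rabs_mult, Rabs_pos_eq; [ring|].
      replace ((y - x) * (y - x)) with ((y - x) ^ 2) by ring. apply pow2_ge_0.
Qed.

(** Raising the curvature of the Taylor parabola by [eps] makes it touch [U] from above near [x];
    then [eps] tends to 0. *)
Lemma upper_jets_C2 (G : R -> R -> R) (U phi : R -> R) (x : R) :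
  upper_jets G U -> 0 < x -> C2 phi ->
  (forall y, 0 < y -> U y - phi y <= U x - phi x) ->
  G (Derive phi x) (U x) <= Derive (Derive phi) x.
Proof.
  intros HJ Hx Hphi Hmax. apply le_epsilon. intros eps Heps.
  destruct (C2_taylor phi x (eps / 2) Hphi ltac:(lra)) as [d [Hd HT]].
  apply (HJ x _ _ d Hx Hd). intros y Hy Hyd.
  assert (A := HT y Hyd). assert (B := Hmax y Hy).
  apply Rabs_le_between in A. unfold quad in *. lra.
Qed.

Definition quartic (a p X N x y : R) : R := quad a p X x y + N * (y - x) ^ 4.

Lemma quartic_derive (a p X N x : R) :
  Derive (quartic a p X N x) = fun y => p + X * (y - x) + 4 * N * (y - x) ^ 3.
Proof.
  extensionality y. apply is_derive_unique. unfold quartic, quad.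
  auto_derive; [exact I|]. field.
Qed.

Lemma quartic_derive2 (a p X N x : R) :
  Derive (Derive (quartic a p X N x)) = fun y => X + 12 * N * (y - x) ^ 2.
Proof.
  rewrite quartic_derive. extensionality y. apply is_derive_unique.
  auto_derive; [exact I|]. ring.
Qed.

Lemma quartic_C2 (a p X N x : R) : C2 (quartic a p X N x).
Proof.
  split; [|split]; intros y.
  - unfold quartic, quad. auto_derive. exact I.
  - rewrite quartic_derive. auto_derive. exact I.
  - rewrite quartic_derive2. apply @ex_derive_continuous. auto_derive. exact I.
Qed.

(* A local jet of a bounded function becomes a global test function once a large
   quartic, invisible at second order, is added. *)
Lemma bounded_quartic_above (U : R -> R) (K x p X d : R) :
  bounded_on U K -> 0 < x -> 0 < d ->
  (forall y, 0 < y -> Rabs (y - x) < d -> U y <= quad (U x) p X x y) ->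
  exists N, forall y, 0 < y -> U y <= quartic (U x) p X N x y.
Proof.
  intros HK Hx Hd Hloc.
  (* At distance at least [d], the three terms absorb in turn the oscillation of [U], the linear
     term and the quadratic term. *)
  set (N := 2 * K / d ^ 4 + Rabs p / d ^ 3 + Rabs X / (2 * d ^ 2)).
  exists N. intros y Hy.
  assert (HK0 := bounded_on_nonneg U K HK).
  assert (Ap := Rabs_pos p). assert (AX := Rabs_pos X).
  assert (d2 : 0 < d ^ 2) by (apply pow_lt; assumption).
  assert (d3 : 0 < d ^ 3) by (apply pow_lt; assumption).
  assert (d4 : 0 < d ^ 4) by (apply pow_lt; assumption).
  assert (Np : 0 <= 2 * K / d ^ 4) by (apply Rdiv_le_0_compat; lra).
  assert (Nq : 0 <= Rabs p / d ^ 3) by (apply Rdiv_le_0_compat; lra).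
  assert (Nr : 0 <= Rabs X / (2 * d ^ 2)) by (apply Rdiv_le_0_compat; lra).
  unfold quartic.
  set (t := Rabs (y - x)).
  assert (Ht0 : 0 <= t) by apply Rabs_pos.
  assert (Ht2 : (y - x) ^ 2 = t ^ 2) by (unfold t; rewrite RPow_abs, Rabs_pos_eq; [reflexivity|apply pow2_ge_0]).
  assert (Ht4 : (y - x) ^ 4 = t ^ 4).
  { replace ((y - x) ^ 4) with (((y - x) ^ 2) ^ 2) by ring. rewrite Ht2. ring. }
  destruct (Rlt_le_dec t d) as [Hlt|Hge].
  - assert (A := Hloc y Hy Hlt).
    assert (0 <= N * (y - x) ^ 4); [|lra].
    rewrite Ht4. apply Rmult_le_pos; [unfold N; lra|apply pow_le; exact Ht0].
  - assert (Ux := HK x ltac:(lra)). assert (Uy := HK y ltac:(lra)).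
    apply Rabs_le_between in Ux. apply Rabs_le_between in Uy.
    unfold quad. rewrite Ht4, Ht2.
    assert (B1 : - (Rabs p * t) <= p * (y - x)).
    { unfold t. rewrite <- Rabs_mult.
      assert (Z := Rle_abs (- (p * (y - x)))). rewrite Rabs_Ropp in Z. lra. }
    assert (B2 : - (Rabs X / 2 * t ^ 2) <= X / 2 * t ^ 2).
    { assert (Z := Rle_abs (- X)). rewrite Rabs_Ropp in Z.
      assert (0 <= t ^ 2) by (apply pow_le; exact Ht0). nra. }
    assert (Hd4 : d ^ 4 <= t ^ 4) by (apply pow_incr; lra).
    assert (Hd3 : d ^ 3 <= t ^ 3) by (apply pow_incr; lra).
    assert (Hd2 : d ^ 2 <= t ^ 2) by (apply pow_incr; lra).
    assert (E1 : 2 * K <= 2 * K / d ^ 4 * t ^ 4).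
    { replace (2 * K) with (2 * K / d ^ 4 * d ^ 4) at 1 by (field; repeat split; lra).
      apply Rmult_le_compat_l; lra. }
    assert (E2 : Rabs p * t <= Rabs p / d ^ 3 * t ^ 4).
    { replace (Rabs p * t) with (Rabs p / d ^ 3 * (t * d ^ 3)) by (field; repeat split; lra).
      apply Rmult_le_compat_l; [lra|]. replace (t ^ 4) with (t * t ^ 3) by ring.
      apply Rmult_le_compat_l; lra. }
    assert (E3 : Rabs X / 2 * t ^ 2 <= Rabs X / (2 * d ^ 2) * t ^ 4).
    { replace (Rabs X / 2 * t ^ 2) with (Rabs X / (2 * d ^ 2) * (t ^ 2 * d ^ 2))
        by (field; repeat split; lra).
      apply Rmult_le_compat_l; [lra|]. replace (t ^ 4) with (t ^ 2 * t ^ 2) by ring.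
      apply Rmult_le_compat_l; [apply pow_le; exact Ht0|lra]. }
    unfold N. lra.
Qed.

(* [opE >= 0] at a test function [phi] reads [jet_sub (phi') u <= phi'']. *)
Definition jet_sub (sigma c : R) (f : R -> R) (p u : R) : R :=
  2 / sigma ^ 2 * (c * u - f p).

(** The nonlinearity of the equation for [- v] when [v'' = G v' v]; it turns supersolutions into
    subsolutions. *)
Definition jet_flip (G : R -> R -> R) (p u : R) : R := - G (- p) (- u).

Lemma opE_ge0 (mu sigma c a lambda : R) (phi : R -> R) (ux x : R) : 0 < sigma ->
  opE mu sigma c a lambda phi ux x >= 0 <->
  jet_sub sigma c (fH mu a lambda) (Derive phi x) ux <= Derive (Derive phi) x.
Proof.
  intros Hs. unfold opE, jet_sub. assert (0 < sigma ^ 2) by (apply pow_lt; exact Hs).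
  set (X := Derive (Derive phi) x). set (F := fH mu a lambda (Derive phi x)).
  assert (E : / 2 * sigma ^ 2 * X + F - c * ux
    = sigma ^ 2 / 2 * (X - 2 / sigma ^ 2 * (c * ux - F))) by (field; repeat split; lra).
  rewrite E. split; intro H'.
  - apply Rge_le in H'. apply Rnot_lt_le; intro.
    assert (0 < sigma ^ 2 / 2 * (2 / sigma ^ 2 * (c * ux - F) - X))
      by (apply Rmult_lt_0_compat; lra). lra.
  - apply Rle_ge, Rmult_le_pos; lra.
Qed.

Lemma opE_le0 (mu sigma c a lambda : R) (phi : R -> R) (ux x : R) : 0 < sigma ->
  opE mu sigma c a lambda phi ux x <= 0 <->
  Derive (Derive phi) x <= jet_sub sigma c (fH mu a lambda) (Derive phi x) ux.
Proof.
  intros Hs. unfold opE, jet_sub. assert (0 < sigma ^ 2) by (apply pow_lt; exact Hs).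
  set (X := Derive (Derive phi) x). set (F := fH mu a lambda (Derive phi x)).
  assert (E : / 2 * sigma ^ 2 * X + F - c * ux
    = - (sigma ^ 2 / 2 * (2 / sigma ^ 2 * (c * ux - F) - X))) by (field; repeat split; lra).
  rewrite E. split; intro H'.
  - apply Rnot_lt_le; intro.
    assert (0 < sigma ^ 2 / 2 * (X - 2 / sigma ^ 2 * (c * ux - F)))
      by (apply Rmult_lt_0_compat; lra). lra.
  - assert (0 <= sigma ^ 2 / 2 * (2 / sigma ^ 2 * (c * ux - F) - X))
      by (apply Rmult_le_pos; lra). lra.
Qed.

Lemma visc_sub_upper_jets (mu sigma c a lambda K : R) (u : R -> R) :
  0 < sigma -> bounded_on u K -> visc_sub mu sigma c a lambda u ->
  upper_jets (jet_sub sigma c (fH mu a lambda)) u.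
Proof.
  intros Hs HK (_ & _ & H) x p X d Hx Hd Hloc.
  destruct (bounded_quartic_above u K x p X d HK Hx Hd Hloc) as [N HN].
  assert (Ex : quartic (u x) p X N x x = u x) by (unfold quartic, quad; ring).
  assert (A := H x (quartic (u x) p X N x) Hx (quartic_C2 _ _ _ _ _)).
  apply opE_ge0 in A; [|assumption| |].
  - rewrite quartic_derive2, quartic_derive, !Rminus_diag in A.
    replace (p + X * 0 + 4 * N * 0 ^ 3) with p in A by ring.
    replace (X + 12 * N * 0 ^ 2) with X in A by ring. exact A.
  - rewrite Ex; ring.
  - intros y Hy. rewrite Ex. assert (B := HN y Hy). lra.
Qed.

Lemma visc_super_upper_jets (mu sigma c a lambda K : R) (v : R -> R) :
  0 < sigma -> bounded_on v K -> visc_super mu sigma c a lambda v ->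
  upper_jets (jet_flip (jet_sub sigma c (fH mu a lambda))) (fun x => - v x).
Proof.
  intros Hs HK (_ & _ & H) x p X d Hx Hd Hloc.
  assert (HK' : bounded_on (fun t => - v t) K)
    by (intros t Ht; rewrite Rabs_Ropp; apply HK, Ht).
  destruct (bounded_quartic_above _ K x p X d HK' Hx Hd Hloc) as [N HN].
  assert (Ex : quartic (v x) (- p) (- X) (- N) x x = v x)
    by (unfold quartic, quad; ring).
  assert (A := H x (quartic (v x) (- p) (- X) (- N) x) Hx (quartic_C2 _ _ _ _ _)).
  apply opE_le0 in A; [|assumption| |].
  - rewrite quartic_derive2, quartic_derive, !Rminus_diag in A.
    replace (- p + - X * 0 + 4 * - N * 0 ^ 3) with (- p) in A by ring.
    replace (- X + 12 * - N * 0 ^ 2) with (- X) in A by ring.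
    unfold jet_flip. rewrite Ropp_involutive. lra.
  - rewrite Ex; ring.
  - intros y Hy. rewrite Ex. assert (B := HN y Hy).
    unfold quartic, quad in *. lra.
Qed.

Lemma upper_jets_visc_sub (mu sigma c a lambda : R) (u : R -> R) :
  0 < sigma -> usc_on u -> u 0 = 0 ->
  upper_jets (jet_sub sigma c (fH mu a lambda)) u ->
  visc_sub mu sigma c a lambda u.
Proof.
  intros Hs Husc H0 HJ. split; [exact Husc|]. split; [exact H0|].
  intros x phi Hx Hphi _ Hmax. apply opE_ge0; [assumption|].
  apply (upper_jets_C2 _ u phi x); assumption.
Qed.

Lemma upper_jets_visc_super (mu sigma c a lambda : R) (v : R -> R) :
  0 < sigma -> lsc_on v -> v 0 = 0 ->
  upper_jets (jet_flip (jet_sub sigma c (fH mu a lambda))) (fun x => - v x) ->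
  visc_super mu sigma c a lambda v.
Proof.
  intros Hs Hlsc H0 HJ. split; [exact Hlsc|]. split; [exact H0|].
  intros x phi Hx (D1 & D2 & D3) _ Hmin. apply opE_le0; [assumption|].
  assert (E1 : Derive (fun y => - phi y) = fun y => - Derive phi y)
    by (extensionality y; apply Derive_opp).
  assert (E2 : Derive (Derive (fun y => - phi y)) = fun y => - Derive (Derive phi) y)
    by (rewrite E1; extensionality y; apply Derive_opp).
  assert (A := upper_jets_C2 _ _ (fun y => - phi y) x HJ Hx).
  rewrite E2, E1 in A. unfold jet_flip in A. rewrite !Ropp_involutive in A.
  apply Ropp_le_cancel, A.
  - split; [|split]; intros y.
    + apply @ex_derive_opp, D1.
    + rewrite E1. apply @ex_derive_opp, D2.
    + rewrite E2. apply @continuous_opp, D3.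
  - intros y Hy. assert (B := Hmin y Hy). lra.
Qed.

Lemma jet_sub_lip2 (sigma c Lf : R) (f : R -> R) :
  0 < sigma -> 0 < c -> lipschitz f Lf ->
  lip2 (jet_sub sigma c f) (2 / sigma ^ 2 * (c + Lf)).
Proof.
  intros Hs Hc [HL Hf]. assert (Hk : 0 < 2 / sigma ^ 2)
    by (apply Rdiv_lt_0_compat; [lra|apply pow_lt; exact Hs]).
  split; [apply Rmult_le_pos; lra|].
  intros p p' u u'. unfold jet_sub. rewrite <- Rmult_minus_distr_l, Rabs_mult.
  rewrite (Rabs_pos_eq (2 / sigma ^ 2)), Rmult_assoc by lra.
  apply Rmult_le_compat_l; [lra|].
  replace (c * u - f p - (c * u' - f p')) with (c * (u - u') + - (f p - f p')) by ring.
  eapply Rle_trans; [apply Rabs_triang|].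
  rewrite Rabs_Ropp, Rabs_mult, (Rabs_pos_eq c) by lra.
  assert (A := Hf p p'). assert (B1 := Rabs_pos (u - u')). assert (B2 := Rabs_pos (p - p')).
  nra.
Qed.

Lemma jet_flip_lip2 (G : R -> R -> R) (L : R) : lip2 G L -> lip2 (jet_flip G) L.
Proof.
  intros [HL H]. split; [exact HL|]. intros p p' u u'. unfold jet_flip.
  replace (- G (- p) (- u) - - G (- p') (- u'))
    with (- (G (- p) (- u) - G (- p') (- u'))) by ring.
  rewrite Rabs_Ropp.
  rewrite <- (Rabs_Ropp (p - p')), <- (Rabs_Ropp (u - u')).
  replace (- (p - p')) with (- p - - p') by ring.
  replace (- (u - u')) with (- u - - u') by ring. apply H.
Qed.

Lemma lsc_on_opp (v : R -> R) : lsc_on v -> usc_on (fun x => - v x).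
Proof.
  intros H x Hx eps Heps. destruct (H x Hx eps Heps) as [d [Hd Hn]].
  exists d. split; [exact Hd|]. intros y Hy Hyd. assert (A := Hn y Hy Hyd). lra.
Qed.

Lemma visc_comparison (mu sigma c a lambda : R) (vbar vlow : R -> R) :
  0 < sigma -> 0 < c -> 0 < a -> 0 < lambda ->
  visc_super mu sigma c a lambda vbar -> classL vbar ->
  visc_sub mu sigma c a lambda vlow -> classL vlow ->
  forall x, 0 <= x -> vlow x <= vbar x.
Proof.
  intros Hs Hc Ha Hl Hbar (_ & K1 & HK1) Hlow (_ & K2 & HK2) x Hx.
  assert (Hf := fH_lipschitz mu a lambda Ha Hl).
  assert (HG := jet_sub_lip2 sigma c _ _ Hs Hc Hf).
  set (K := Rmax K1 K2).
  assert (B1 : bounded_on vbar K).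
  { intros t Ht. apply Rle_trans with (1 := HK1 t Ht), Rmax_l. }
  assert (B2 : bounded_on vlow K).
  { intros t Ht. apply Rle_trans with (1 := HK2 t Ht), Rmax_r. }
  assert (B1' : bounded_on (fun t => - vbar t) K)
    by (intros t Ht; rewrite Rabs_Ropp; apply B1, Ht).
  assert (Hk : 0 < 2 / sigma ^ 2)
    by (apply Rdiv_lt_0_compat; [lra|apply pow_lt; exact Hs]).
  assert (A := upper_jets_comparison (jet_sub sigma c (fH mu a lambda))
    (jet_flip (jet_sub sigma c (fH mu a lambda))) vlow (fun t => - vbar t)
    _ K (2 / sigma ^ 2 * c) (2 / sigma ^ 2 * (Rabs mu + a))
    (proj1 Hlow) (visc_sub_upper_jets _ _ _ _ _ K _ Hs B2 Hlow) B2 HG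
    (lsc_on_opp _ (proj1 Hbar)) (visc_super_upper_jets _ _ _ _ _ K _ Hs B1 Hbar) B1'
    (jet_flip_lip2 _ _ HG)).
  assert (vlow x + - vbar x <= 0); [|lra]. apply A; try assumption.
  - rewrite (proj1 (proj2 Hlow)), (proj1 (proj2 Hbar)). lra.
  - apply Rmult_lt_0_compat; assumption.
  - apply Rmult_le_pos; [lra|apply Hf].
  (* The zero-order term [c * u] gives the strict monotonicity in [u + u']; the Hamiltonian is
     evaluated at two slopes differing by [delta], at a cost of its Lipschitz constant times
     [delta]. *)
  - intros p delta u u' Hde. unfold jet_flip, jet_sub.
    assert (C := proj2 Hf p (- (delta - p))).
    replace (p - - (delta - p)) with delta in C by ring.
    rewrite (Rabs_pos_eq delta) in C by assumption.
    apply Rabs_le_between in C.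
    set (F1 := fH mu a lambda p) in *. set (F2 := fH mu a lambda (- (delta - p))) in *.
    replace (2 / sigma ^ 2 * (c * u - F1) + - (2 / sigma ^ 2 * (c * - u' - F2)))
      with (2 / sigma ^ 2 * (c * (u + u') - (F1 - F2))) by ring.
    rewrite !Rmult_assoc, <- Rmult_minus_distr_l.
    apply Rmult_le_compat_l; lra.
Qed.

(** * Perron's method *)

(** [real] sends infinite values to 0, so nonemptiness and a bound are what make it a genuine
    supremum. *)
Lemma Lub_Rbar_real (E : R -> Prop) (b : R) :
  (exists r, E r) -> (forall r, E r -> r <= b) ->
  (forall r, E r -> r <= real (Lub_Rbar E)) /\
  (forall m, (forall r, E r -> r <= m) -> real (Lub_Rbar E) <= m).
Proof.
  intros [r0 H0] Hb. destruct (Lub_Rbar_correct E) as [Hub Hlub].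
  assert (Hfin : Rbar_le (Lub_Rbar E) (Finite b)) by (apply Hlub; intros r Hr; apply Hb, Hr).
  assert (H0' := Hub r0 H0).
  destruct (Lub_Rbar E) as [l| |]; simpl in *; try contradiction.
  split; [intros r Hr; apply (Hub r Hr)|].
  intros m Hm. apply (Hlub (Finite m)). intros r Hr. apply Hm, Hr.
Qed.

Lemma Glb_Rbar_real (E : R -> Prop) (b : R) :
  (exists r, E r) -> (forall r, E r -> b <= r) ->
  (forall r, E r -> real (Glb_Rbar E) <= r) /\
  (forall m, (forall r, E r -> m <= r) -> m <= real (Glb_Rbar E)).
Proof.
  intros [r0 H0] Hb. destruct (Glb_Rbar_correct E) as [Hlb Hglb].
  assert (Hfin : Rbar_le (Finite b) (Glb_Rbar E)) by (apply Hglb; intros r Hr; apply Hb, Hr).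
  assert (H0' := Hlb r0 H0).
  destruct (Glb_Rbar E) as [l| |]; simpl in *; try contradiction.
  split; [intros r Hr; apply (Hlb r Hr)|].
  intros m Hm. apply (Hglb (Finite m)). intros r Hr. apply Hm, Hr.
Qed.

Lemma usc_env_cont (v : R -> R) (K x : R) :
  bounded_on v K -> cont_on v -> 0 <= x -> usc_env v x = v x.
Proof.
  intros HK Hc Hx.
  assert (HS : forall d, 0 < d ->
    (forall r, (exists y, 0 <= y /\ Rabs (y - x) < d /\ r = v y) ->
       r <= real (Lub_Rbar (fun r => exists y, 0 <= y /\ Rabs (y - x) < d /\ r = v y))) /\
    (forall m, (forall r, (exists y, 0 <= y /\ Rabs (y - x) < d /\ r = v y) -> r <= m) ->
       real (Lub_Rbar (fun r => exists y, 0 <= y /\ Rabs (y - x) < d /\ r = v y)) <= m)).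
  { intros d Hd. apply Lub_Rbar_real with K.
    - exists (v x), x. rewrite Rminus_diag, Rabs_R0. auto.
    - intros r (y & Hy & _ & ->). assert (A := HK y Hy).
      apply Rabs_le_between in A. lra. }
  assert (Hlow : forall s, (exists d, 0 < d /\
      s = real (Lub_Rbar (fun r => exists y, 0 <= y /\ Rabs (y - x) < d /\ r = v y))) ->
    v x <= s).
  { intros s (d & Hd & ->). apply HS; [exact Hd|].
    exists x. rewrite Rminus_diag, Rabs_R0. auto. }
  destruct (Glb_Rbar_real _ (v x) (ex_intro _ _ (ex_intro _ 1 (conj Rlt_0_1 eq_refl))) Hlow)
    as [G1 G2].
  apply Rle_antisym; [|apply G2, Hlow].
  apply le_epsilon. intros eps Heps. destruct (Hc x Hx eps Heps) as [d [Hd Hn]].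
  eapply Rle_trans; [apply G1; exists d; split; [exact Hd|reflexivity]|].
  apply HS; [exact Hd|]. intros r (y & Hy & Hyd & ->).
  assert (A := Hn y Hy Hyd). apply Rabs_def2 in A. lra.
Qed.

Lemma lsc_env_cont (v : R -> R) (K x : R) :
  bounded_on v K -> cont_on v -> 0 <= x -> lsc_env v x = v x.
Proof.
  intros HK Hc Hx.
  assert (HS : forall d, 0 < d ->
    (forall r, (exists y, 0 <= y /\ Rabs (y - x) < d /\ r = v y) ->
       real (Glb_Rbar (fun r => exists y, 0 <= y /\ Rabs (y - x) < d /\ r = v y)) <= r) /\
    (forall m, (forall r, (exists y, 0 <= y /\ Rabs (y - x) < d /\ r = v y) -> m <= r) ->
       m <= real (Glb_Rbar (fun r => exists y, 0 <= y /\ Rabs (y - x) < d /\ r = v y)))).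
  { intros d Hd. apply Glb_Rbar_real with (- K).
    - exists (v x), x. rewrite Rminus_diag, Rabs_R0. auto.
    - intros r (y & Hy & _ & ->). assert (A := HK y Hy).
      apply Rabs_le_between in A. lra. }
  assert (Hup : forall s, (exists d, 0 < d /\
      s = real (Glb_Rbar (fun r => exists y, 0 <= y /\ Rabs (y - x) < d /\ r = v y))) ->
    s <= v x).
  { intros s (d & Hd & ->). apply HS; [exact Hd|].
    exists x. rewrite Rminus_diag, Rabs_R0. auto. }
  destruct (Lub_Rbar_real _ (v x) (ex_intro _ _ (ex_intro _ 1 (conj Rlt_0_1 eq_refl))) Hup)
    as [G1 G2].
  apply Rle_antisym; [apply G2, Hup|].
  apply le_epsilon. intros eps Heps. destruct (Hc x Hx eps Heps) as [d [Hd Hn]].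
  apply Rle_trans with
    (real (Glb_Rbar (fun r => exists y, 0 <= y /\ Rabs (y - x) < d /\ r = v y)) + eps).
  - assert (v x - eps <= real (Glb_Rbar
      (fun r => exists y, 0 <= y /\ Rabs (y - x) < d /\ r = v y))); [|lra].
    apply HS; [exact Hd|]. intros r (y & Hy & Hyd & ->).
    assert (A := Hn y Hy Hyd). apply Rabs_def2 in A. lra.
  - apply Rplus_le_compat_r. apply G1. exists d. split; [exact Hd|reflexivity].
Qed.

Lemma cont_on_usc (u : R -> R) : cont_on u -> usc_on u.
Proof.
  intros H x Hx eps Heps. destruct (H x Hx eps Heps) as [d [Hd Hn]].
  exists d. split; [exact Hd|]. intros y Hy Hyd.
  assert (A := Hn y Hy Hyd). apply Rabs_def2 in A. lra.
Qed.

Lemma cont_on_lsc (u : R -> R) : cont_on u -> lsc_on u.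
Proof.
  intros H x Hx eps Heps. destruct (H x Hx eps Heps) as [d [Hd Hn]].
  exists d. split; [exact Hd|]. intros y Hy Hyd.
  assert (A := Hn y Hy Hyd). apply Rabs_def2 in A. lra.
Qed.

(** Monotonicity gives one side of each estimate. To the left of [x] the Lipschitz bound is applied
    from the base point [y]. *)
Lemma increasing_right_lipschitz_cont (u : R -> R) (rho N : R) :
  (forall x y, 0 <= x -> x <= y -> u x <= u y) -> 0 < rho -> 0 <= N ->
  (forall x y, 0 <= x -> x <= y <= x + rho -> u y <= u x + N * (y - x)) ->
  cont_on u.
Proof.
  intros Hinc Hr HN Hlip x Hx eps Heps.
  assert (Hq : 0 < eps / (N + 1)) by (apply Rdiv_lt_0_compat; lra).
  exists (Rmin rho (eps / (N + 1))). split; [apply Rmin_pos; lra|].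
  intros y Hy Hd.
  assert (D1 := Rlt_le_trans _ _ _ Hd (Rmin_l _ _)).
  assert (D2 := Rlt_le_trans _ _ _ Hd (Rmin_r _ _)).
  apply Rmult_lt_compat_l with (r := N + 1) in D2; [|lra].
  replace ((N + 1) * (eps / (N + 1))) with eps in D2 by (field; lra).
  assert (Hp := Rabs_pos (y - x)).
  assert (A0 : N * Rabs (y - x) <= (N + 1) * Rabs (y - x))
    by (apply Rmult_le_compat_r; lra).
  destruct (Rle_lt_dec x y) as [Hle|Hlt].
  - rewrite (Rabs_pos_eq (y - x)) in * by lra.
    assert (A := Hlip x y Hx ltac:(lra)). assert (B := Hinc x y Hx Hle).
    rewrite Rabs_pos_eq; lra.
  - rewrite (Rabs_left (y - x)) in * by lra.
    assert (A := Hlip y x Hy ltac:(lra)). assert (B := Hinc y x Hy ltac:(lra)).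
    rewrite Rabs_left1; lra.
Qed.

(** The constants are quantified before [U], so that the bound passes to the supremum of a
    family. *)
Lemma upper_jets_right_slope (G : R -> R -> R) (L K : R) : lip2 G L -> 0 <= K ->
  exists rho N, 0 < rho /\ 0 <= N /\
    forall U, usc_on U -> upper_jets G U -> bounded_on U K ->
      forall x y, 0 <= x -> x <= y <= x + rho -> U y <= U x + N * (y - x).
Proof.
  intros HG HK0. assert (HL := proj1 HG).
  assert (Hi : 0 < / (L + 1)) by (apply Rinv_0_lt_compat; lra).
  assert (HN := slope_bound_pos G L K (/ (L + 1)) HL HK0 Hi).
  exists (/ (L + 1)), (slope_bound G L K (/ (L + 1))).
  split; [exact Hi|]. split; [lra|].
  intros U Husc HJ HK x y Hx Hy.
  assert (A := upper_jets_slope G U L K (/ (L + 1)) Husc HJ HK HG Hi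
    ltac:(rewrite Rinv_l; lra) x y Hx ltac:(lra)).
  rewrite (Rabs_pos_eq (y - x)) in A by lra. apply A; lra.
Qed.

(** If the curvature [X] were too small, a slightly more curved and lower parabola would still be an
    upper barrier for every member of [F], pushing the supremum at [x0] strictly below [v x0]. *)
Lemma sup_upper_jets (G : R -> R -> R) (L : R) (F : (R -> R) -> Prop) (v : R -> R) :
  lip2 G L -> (forall u, F u -> usc_on u /\ upper_jets G u) ->
  (forall u x, F u -> 0 <= x -> u x <= v x) ->
  (forall x m, 0 <= x -> (forall u, F u -> u x <= m) -> v x <= m) ->
  upper_jets G v.
Proof.
  intros HG HF Hub Hlub x0 p X d Hx0 Hd Hloc.
  apply Rnot_lt_le. intro Hlt. assert (HL := proj1 HG).
  set (gap := G p (v x0) - X). assert (Hgap : 0 < gap) by (unfold gap; lra).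
  set (tau := gap / (8 * (L + 1))).
  assert (Htau : 0 < tau) by (apply Rdiv_lt_0_compat; lra).
  assert (HLt : L * (2 * tau) < gap / 2).
  { replace gap with (8 * (L + 1) * tau) by (unfold tau; field; lra). nra. }
  assert (Ap := Rabs_pos p). assert (AX := Rabs_pos X).
  set (D := Rabs p + Rabs X + gap + 1).
  set (r := Rmin (Rmin (d / 2) (x0 / 2)) (Rmin 1 (tau / D))).
  assert (HDp : 1 <= D) by (unfold D; lra).
  assert (Hr0 : 0 < r).
  { unfold r. repeat apply Rmin_pos; try lra. apply Rdiv_lt_0_compat; lra. }
  assert (H1 : r <= d / 2) by (unfold r; eapply Rle_trans; [apply Rmin_l|apply Rmin_l]).
  assert (H2 : r <= x0 / 2) by (unfold r; eapply Rle_trans; [apply Rmin_l|apply Rmin_r]).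
  assert (H3 : r <= 1) by (unfold r; eapply Rle_trans; [apply Rmin_r|apply Rmin_l]).
  assert (H4 : D * r <= tau).
  { apply Rle_trans with (D * (tau / D)).
    - apply Rmult_le_compat_l; [lra|].
      unfold r; eapply Rle_trans; [apply Rmin_r|apply Rmin_r].
    - apply Req_le; field; lra. }
  assert (Hr2 : 0 < r ^ 2 <= r) by (split; [apply pow_lt; lra|nra]).
  assert (Hgr : 0 < gap * r ^ 2) by (apply Rmult_lt_0_compat; lra).
  assert (Hv : v x0 <= v x0 - gap / 4 * r ^ 2); [|lra].
  apply Hlub; [lra|]. intros u Fu. destruct (HF u Fu) as [Husc HJ].
  (* Adding [gap / 2] to the curvature raises the parabola by [gap / 4 * r ^ 2] at the end points,
     exactly the amount by which it is lowered. *)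
  assert (HB : forall y, x0 - r <= y <= x0 + r ->
    u y <= quad (v x0 - gap / 4 * r ^ 2) p (X + gap / 2) x0 y).
  { apply (quad_barrier G u); try assumption; try lra.
    - assert (A := Hloc (x0 - r) ltac:(lra) ltac:(rewrite Rabs_left; lra)).
      assert (B := Hub u (x0 - r) Fu ltac:(lra)).
      unfold quad in *. lra.
    - assert (A := Hloc (x0 + r) ltac:(lra) ltac:(rewrite Rabs_pos_eq; lra)).
      assert (B := Hub u (x0 + r) Fu ltac:(lra)).
      unfold quad in *. lra.
    - intros y Hy Hq.
      assert (A := Hloc y ltac:(lra) ltac:(apply Rabs_def1; lra)).
      assert (B := Hub u y Fu ltac:(lra)).
      unfold quad in A, Hq. set (h := y - x0) in *.
      assert (Hh : Rabs h <= r) by (unfold h; apply Rabs_le_between; lra).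
      assert (Hh0 := Rabs_pos h).
      assert (Hh2 : h ^ 2 <= r).
      { replace (h ^ 2) with (Rabs h ^ 2); [|apply pow2_abs]. nra. }
      assert (Hh2' := pow2_ge_0 h).
      assert (Eph : Rabs (p * h) <= Rabs p * r)
        by (rewrite Rabs_mult; apply Rmult_le_compat_l; lra).
      assert (EXh : Rabs (X * h) <= Rabs X * r)
        by (rewrite Rabs_mult; apply Rmult_le_compat_l; lra).
      assert (EX2 : Rabs (X * h ^ 2) <= Rabs X * r)
        by (rewrite Rabs_mult, (Rabs_pos_eq (h ^ 2)) by lra;
            apply Rmult_le_compat_l; lra).
      assert (Egh : Rabs (gap * h) <= gap * r)
        by (rewrite Rabs_mult, (Rabs_pos_eq gap) by lra; apply Rmult_le_compat_l; lra).
      assert (Egr : gap * r ^ 2 <= gap * r) by (apply Rmult_le_compat_l; lra).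
      assert (Egh2 : 0 <= gap * h ^ 2) by (apply Rmult_le_pos; lra).
      apply Rabs_le_between in Eph. apply Rabs_le_between in EXh.
      apply Rabs_le_between in EX2. apply Rabs_le_between in Egh.
      unfold D in H4.
      assert (HR : 0 <= Rabs p * r /\ 0 <= Rabs X * r /\ 0 <= gap * r)
        by (repeat split; apply Rmult_le_pos; lra).
      assert (C1 : Rabs (v x0 - u y) <= tau) by (apply Rabs_le_between; lra).
      assert (C2 : Rabs (p - (p + (X + gap / 2) * h)) <= tau)
        by (apply Rabs_le_between; lra).
      assert (C3 := proj2 HG p (p + (X + gap / 2) * h) (v x0) (u y)).
      assert (C4 := Rle_abs (G p (v x0) - G (p + (X + gap / 2) * h) (u y))).
      assert (L * (Rabs (p - (p + (X + gap / 2) * h)) + Rabs (v x0 - u y))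
        <= L * (2 * tau)) by (apply Rmult_le_compat_l; lra).
      unfold gap in *. lra. }
  assert (A := HB x0 ltac:(lra)). unfold quad in A.
  rewrite Rminus_diag in A. lra.
Qed.

(** Competitors lie above [v], as bumps do, and belong to class (L), so a bump has to be increasing.
    The upper barrier is not imposed on them; comparison will provide it. *)
Definition maximal_subsolution (G : R -> R -> R) (v : R -> R) : Prop :=
  usc_on v /\ v 0 = 0 /\ classL v /\ upper_jets G v /\
  forall w, usc_on w -> w 0 = 0 -> classL w -> upper_jets G w ->
    (forall x, 0 <= x -> v x <= w x) -> forall x, 0 <= x -> w x <= v x.

(** The competitor [w] is [v] up to [l] and the maximum of [v] and [Q] afterwards. On the strip from
    [l] to [l'] the maximum is still [v], so the gluing creates no new jet; elsewhere a parabola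
    touching [w] from above touches [v] or [Q]. *)
Lemma maximal_subsolution_bump (G : R -> R -> R) (v Q : R -> R) (l l' K' : R) :
  maximal_subsolution G v -> 0 <= l -> l < l' ->
  (forall x eps, 0 < eps -> exists delta, 0 < delta /\
     forall y, Rabs (y - x) < delta -> Q y < Q x + eps) ->
  (forall x y, l <= x -> x <= y -> Q x <= Q y) ->
  (forall x, l <= x -> Q x <= K') ->
  (forall x, l <= x <= l' -> Q x <= v x) ->
  (forall x, l' < x -> v x < Q x ->
     forall p X d, 0 < d ->
       (forall y, Rabs (y - x) < d -> Q y <= quad (Q x) p X x y) -> G p (Q x) <= X) ->
  forall x, l <= x -> Q x <= v x.
Proof.
  intros (Husc & H0 & (Hinc & K & HK) & HJ & Hmax) Hl Hll HQc HQi HQK HQv HQJ.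
  set (w := fun x => if Rle_lt_dec x l then v x else Rmax (v x) (Q x)).
  assert (Hvw : forall x, v x <= w x).
  { intros x. unfold w. destruct (Rle_lt_dec x l); [lra|apply Rmax_l]. }
  assert (HQw : forall x, l <= x -> Q x <= w x).
  { intros x Hx. unfold w. destruct (Rle_lt_dec x l); [apply HQv; lra|apply Rmax_r]. }
  assert (Hcase : forall x, w x = v x \/ (l' < x /\ w x = Q x /\ v x < Q x)).
  { intros x. unfold w. destruct (Rle_lt_dec x l) as [|Hlx]; [left; reflexivity|].
    destruct (Rle_lt_dec (Q x) (v x)) as [Hle|Hlt].
    - left. apply Rmax_left, Hle.
    - right. split; [|split; [apply Rmax_right; lra|exact Hlt]].
      apply Rnot_le_lt. intro. assert (Q x <= v x) by (apply HQv; lra). lra. }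
  assert (Hw : forall x, 0 <= x -> w x <= v x).
  { apply Hmax.
    - intros x Hx eps Heps.
      destruct (Husc x Hx eps Heps) as [d1 [Hd1 N1]].
      destruct (HQc x eps Heps) as [d2 [Hd2 N2]].
      assert (Hvx := Hvw x).
      destruct (Rlt_le_dec x l') as [Hxl|Hxl].
      + exists (Rmin d1 (l' - x)). split; [apply Rmin_pos; lra|].
        intros y Hy Hd.
        assert (A := N1 y Hy (Rlt_le_trans _ _ _ Hd (Rmin_l _ _))).
        assert (B := Rlt_le_trans _ _ _ Hd (Rmin_r _ _)). apply Rabs_def2 in B.
        destruct (Hcase y) as [E|[E _]]; lra.
      + assert (HQx := HQw x ltac:(lra)).
        exists (Rmin d1 d2). split; [apply Rmin_pos; lra|].
        intros y Hy Hd.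
        assert (A := N1 y Hy (Rlt_le_trans _ _ _ Hd (Rmin_l _ _))).
        assert (B := N2 y (Rlt_le_trans _ _ _ Hd (Rmin_r _ _))).
        destruct (Hcase y) as [E|(_ & E & _)]; lra.
    - destruct (Hcase 0) as [E|[E _]]; lra.
    - split.
      + intros x y Hx Hxy. destruct (Hcase x) as [E|(Hlx & E & _)]; rewrite E.
        * apply Rle_trans with (v y); [apply Hinc; lra|apply Hvw].
        * apply Rle_trans with (Q y); [apply HQi; lra|apply HQw; lra].
      + exists (Rmax K K'). intros x Hx. assert (A := HK x Hx).
        apply Rabs_le_between in A. assert (B := Hvw x).
        assert (M1 := Rmax_l K K'). assert (M2 := Rmax_r K K').
        apply Rabs_le_between. split; [lra|].
        destruct (Hcase x) as [E|(Hlx & E & _)]; rewrite E; [lra|].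
        assert (C := HQK x ltac:(lra)). lra.
    - intros x p X d Hx Hd Hloc. destruct (Hcase x) as [E|(Hlx & E & Hlt)].
      + rewrite E in *. apply (HJ x p X d Hx Hd). intros y Hy Hyd.
        apply Rle_trans with (1 := Hvw y). apply Hloc; assumption.
      + rewrite E in *. apply (HQJ x Hlx Hlt p X (Rmin d (x - l'))).
        { apply Rmin_pos; lra. }
        intros y Hyd.
        assert (B1 := Rlt_le_trans _ _ _ Hyd (Rmin_l _ _)).
        assert (B2 := Rlt_le_trans _ _ _ Hyd (Rmin_r _ _)). apply Rabs_def2 in B2.
        apply Rle_trans with (w y); [apply HQw; lra|apply Hloc; lra].
    - intros x _. apply Hvw. }
  intros x Hx. apply Rle_trans with (w x); [apply HQw, Hx|apply Hw; lra].
Qed.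

Lemma quad_touch (a p Y p' Y' x d : R) : 0 < d ->
  (forall y, Rabs (y - x) < d -> quad a p Y x y <= quad a p' Y' x y) ->
  p' = p /\ Y <= Y'.
Proof.
  intros Hd H.
  assert (H' : forall h, Rabs h < d -> (p - p') * h <= (Y' - Y) / 2 * h ^ 2).
  { intros h Hh. assert (A := H (x + h)). unfold quad in A.
    replace (x + h - x) with h in A by ring. specialize (A Hh). lra. }
  assert (E : p - p' = 0).
  { apply (quadratic_dominates_linear _ (Rabs (Y' - Y) / 2) (d / 2)).
    - lra.
    - assert (A := Rabs_pos (Y' - Y)). lra.
    - intros h Hh. assert (A := H' h ltac:(lra)).
      assert (B := Rle_abs (Y' - Y)). assert (C := pow2_ge_0 h). nra. }
  split; [lra|].
  assert (A := H' (d / 2) ltac:(rewrite Rabs_pos_eq; lra)). rewrite E in A.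
  assert (0 < (d / 2) ^ 2) by (apply pow_lt; lra). nra.
Qed.

(** Comparing [v (x - t) <= v x] with the parabola gives [X / 2 * t <= p] for small [t > 0]. *)
Lemma increasing_lower_jet (v : R -> R) (x p X d : R) :
  (forall s t, 0 <= s -> s <= t -> v s <= v t) -> 0 < x -> 0 < d ->
  (forall y, 0 < y -> Rabs (y - x) < d -> quad (v x) p X x y <= v y) ->
  0 < p \/ (p = 0 /\ X <= 0).
Proof.
  intros Hinc Hx Hd Hloc.
  assert (H : forall t, 0 < t -> t < x -> t < d -> X / 2 * t <= p).
  { intros t Ht Htx Htd.
    assert (A := Hloc (x - t) ltac:(lra) ltac:(rewrite Rabs_left; lra)).
    assert (B := Hinc (x - t) x ltac:(lra) ltac:(lra)).
    unfold quad in A. replace (x - t - x) with (- t) in A by ring.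
    apply Rmult_le_reg_r with t; lra. }
  destruct (Rtotal_order p 0) as [Hp|[Hp|Hp]]; [exfalso| |left; exact Hp].
  - set (t := Rmin (Rmin (x / 2) (d / 2)) (- p / (Rabs X + 1))).
    assert (AX := Rabs_pos X).
    assert (Ht : 0 < t) by (unfold t; repeat apply Rmin_pos; try lra; apply Rdiv_lt_0_compat; lra).
    assert (T1 : t <= x / 2) by (unfold t; eapply Rle_trans; [apply Rmin_l|apply Rmin_l]).
    assert (T2 : t <= d / 2) by (unfold t; eapply Rle_trans; [apply Rmin_l|apply Rmin_r]).
    assert (T3 : (Rabs X + 1) * t <= - p).
    { apply Rle_trans with ((Rabs X + 1) * (- p / (Rabs X + 1))).
      - apply Rmult_le_compat_l; [lra|apply Rmin_r].
      - apply Req_le; field; lra. }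
    assert (A := H t Ht ltac:(lra) ltac:(lra)).
    assert (B := Rle_abs (- X)). rewrite Rabs_Ropp in B. nra.
  - right. split; [exact Hp|].
    set (t := Rmin (x / 2) (d / 2)).
    assert (Ht : 0 < t) by (apply Rmin_pos; lra).
    assert (T1 : t <= x / 2) by apply Rmin_l. assert (T2 : t <= d / 2) by apply Rmin_r.
    assert (A := H t Ht ltac:(lra) ltac:(lra)). nra.
Qed.

Lemma Rmin_1_lipschitz (a x y : R) : Rabs (Rmin y a - Rmin x a) <= Rabs (y - x).
Proof.
  unfold Rmin. destruct (Rle_dec y a), (Rle_dec x a); unfold Rabs;
    repeat destruct Rcase_abs; lra.
Qed.

(* If a lower jet [(p, X)] at [x0] violates the supersolution inequality, a parabola
   of curvature [Y < X] lifted slightly above [v] at [x0] bumps [v].  Monotonicity of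
   the bump is automatic near [x0] when [p > 0]; when [p = 0] (so [X <= 0]) the parabola
   is frozen at its top for [x >= x0], which only adds a kink with jump [>= 0] of the
   curvature. *)
Lemma maximal_subsolution_super (G : R -> R -> R) (L : R) (v : R -> R) :
  lip2 G L -> maximal_subsolution G v ->
  upper_jets (jet_flip G) (fun x => - v x).
Proof.
  intros HG Hmax x0 p' X' d Hx0 Hd Hloc'.
  unfold jet_flip. rewrite Ropp_involutive.
  apply Rnot_lt_le. intro Hlt. assert (HL := proj1 HG).
  assert (Hinc := proj1 (proj1 (proj2 (proj2 Hmax)))).
  set (p := - p') in *. set (X := - X'). set (v0 := v x0) in *.
  assert (Hloc : forall y, 0 < y -> Rabs (y - x0) < d -> quad v0 p X x0 y <= v y).
  { intros y Hy Hyd. assert (A := Hloc' y Hy Hyd). unfold quad, p, X, v0 in *. lra. }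
  assert (HX : G p v0 < X) by (unfold X; lra).
  assert (Hp := increasing_lower_jet v x0 p X d Hinc Hx0 Hd Hloc).
  (* The midpoint leaves the same [gap] on both sides: below [X] for staying under [v] away from
     [x0], above [G] for the subsolution inequality. *)
  set (Y := (G p v0 + X) / 2). set (gap := Y - G p v0).
  assert (Hgap : 0 < gap) by (unfold gap, Y; lra).
  assert (HXY : X - Y = gap) by (unfold gap, Y; lra).
  assert (HpY : 0 < p \/ (p = 0 /\ Y < 0))
    by (destruct Hp as [|[]]; [left; lra|right; split; lra]).
  assert (Hp0 : 0 <= p) by (destruct HpY as [|[]]; lra).
  set (tau := gap / (4 * (L + 1))).
  assert (Htau : 0 < tau) by (apply Rdiv_lt_0_compat; lra).
  assert (HLt : L * (2 * tau) < gap).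
  { replace gap with (4 * (L + 1) * tau) by (unfold tau; field; lra). nra. }
  assert (AY := Rabs_pos Y).
  (* The parabola is frozen from [x0 + e] on. For [p > 0], [e = r] and [Rabs Y * r < p] keeps it
     increasing; for [p = 0], [e = 0] freezes it at its top. *)
  assert (Hsmall : exists r e, 0 < r /\ r < d /\ r < x0 /\ r <= 1 /\
    (p + Rabs Y) * r <= tau / 2 /\ 0 <= e <= r /\
    ((e = r /\ Rabs Y * r < p) \/ (e = 0 /\ p = 0 /\ Y < 0))).
  { set (b := if Rlt_dec 0 p then p else 1).
    assert (Hb : 0 < b) by (unfold b; destruct (Rlt_dec 0 p); lra).
    set (r := Rmin (Rmin (d / 2) (x0 / 2)) (Rmin 1 (Rmin (tau / 2) (b / 2) / (p + Rabs Y + 1)))).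
    assert (Hm : 0 < Rmin (tau / 2) (b / 2)) by (apply Rmin_pos; lra).
    assert (Hr0 : 0 < r).
    { unfold r. repeat apply Rmin_pos; try lra. apply Rdiv_lt_0_compat; lra. }
    assert (H1 : r <= d / 2) by (unfold r; eapply Rle_trans; [apply Rmin_l|apply Rmin_l]).
    assert (H2 : r <= x0 / 2) by (unfold r; eapply Rle_trans; [apply Rmin_l|apply Rmin_r]).
    assert (H3 : r <= 1) by (unfold r; eapply Rle_trans; [apply Rmin_r|apply Rmin_l]).
    assert (H4 : (p + Rabs Y + 1) * r <= Rmin (tau / 2) (b / 2)).
    { apply Rle_trans with
        ((p + Rabs Y + 1) * (Rmin (tau / 2) (b / 2) / (p + Rabs Y + 1))).
      - apply Rmult_le_compat_l; [lra|].
        unfold r; eapply Rle_trans; [apply Rmin_r|apply Rmin_r].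
      - apply Req_le; field; lra. }
    assert (H5 := Rmin_l (tau / 2) (b / 2)). assert (H6 := Rmin_r (tau / 2) (b / 2)).
    exists r, (if Rlt_dec 0 p then r else 0).
    assert (0 <= p * r) by (apply Rmult_le_pos; lra).
    repeat split; try lra; try (destruct (Rlt_dec 0 p); lra).
    unfold b in *. destruct (Rlt_dec 0 p); [left; split; lra|right; repeat split].
    - destruct HpY as [|[]]; lra.
    - destruct HpY as [|[]]; lra. }
  destruct Hsmall as (r & e & Hr & Hrd & Hrx & Hr1 & Hrt & He & Hcase).
  (* The first bound is the height of the curvature-[X] parabola over the curvature-[Y] one at
     distance [r / 2], so the lift stays below [v] from there to distance [r]. *)
  set (eta := Rmin (gap * r ^ 2 / 8) (tau / 2)).
  assert (Hr2 : 0 < r ^ 2) by (apply pow_lt; lra).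
  assert (Hgr : 0 < gap * r ^ 2) by (apply Rmult_lt_0_compat; lra).
  assert (Heta : 0 < eta) by (apply Rmin_pos; lra).
  assert (He1 : eta <= gap * r ^ 2 / 8) by apply Rmin_l.
  assert (He2 : eta <= tau / 2) by apply Rmin_r.
  set (q := quad (v0 + eta) p Y x0).
  set (Q := fun x => q (Rmin x (x0 + e))).
  assert (HYr : forall h, Rabs h <= r -> Rabs (Y * h) <= Rabs Y * r).
  { intros h Hh. rewrite Rabs_mult. apply Rmult_le_compat_l; lra. }
  assert (Hmin : forall x, x0 - r <= x -> x0 - r <= Rmin x (x0 + e) <= x0 + e).
  { intros x Hx. unfold Rmin. destruct (Rle_dec x (x0 + e)); lra. }
  assert (Hqinc : forall s t, x0 - r <= s -> s <= t -> t <= x0 + e -> q s <= q t).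
  { intros s t Hs Hst Ht.
    assert (E : q t - q s = (t - s) * (p + Y * ((s - x0 + (t - x0)) / 2)))
      by (unfold q, quad; field).
    assert (0 <= (t - s) * (p + Y * ((s - x0 + (t - x0)) / 2))); [|lra].
    apply Rmult_le_pos; [lra|]. destruct Hcase as [[Her HY]|(E0 & Ep & HY)].
    - assert (A := HYr ((s - x0 + (t - x0)) / 2) ltac:(apply Rabs_le_between; lra)).
      apply Rabs_le_between in A. lra.
    - rewrite Ep. assert ((s - x0 + (t - x0)) / 2 <= 0) by lra. nra. }
  assert (Hqv : forall x, r / 2 <= Rabs (x - x0) <= r -> q x <= v x).
  { intros x Hx. assert (A := Hloc x).
    assert (0 < x) by (assert (B := proj1 (Rabs_le_between _ _) (proj2 Hx)); lra).
    specialize (A H ltac:(lra)). apply Rle_trans with (2 := A).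
    unfold q, quad.
    assert (Hsq : r ^ 2 / 4 <= (x - x0) ^ 2).
    { rewrite <- (pow2_abs (x - x0)). replace (r ^ 2 / 4) with ((r / 2) ^ 2) by field.
      apply pow_incr; lra. }
    assert (gap * (r ^ 2 / 4) <= gap * (x - x0) ^ 2) by (apply Rmult_le_compat_l; lra).
    rewrite <- HXY in *. lra. }
  assert (HQv : Q x0 <= v0).
  { apply (maximal_subsolution_bump G v Q (x0 - r) (x0 - r / 2) (q (x0 + e)));
      try assumption; try lra.
    - intros x eps Heps.
      destruct (quad_continuous (v0 + eta) p Y x0 (Rmin x (x0 + e)) eps Heps)
        as [d1 [Hd1 N1]].
      exists d1. split; [exact Hd1|]. intros y Hy.
      assert (A := N1 (Rmin y (x0 + e))
        (Rle_lt_trans _ _ _ (Rmin_1_lipschitz _ _ _) Hy)).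
      apply Rabs_def2 in A. unfold Q, q. lra.
    - intros x y Hx Hxy. unfold Q.
      apply Hqinc; [apply Hmin, Hx| |apply Hmin; lra].
      apply Rle_min_compat_r, Hxy.
    - intros x Hx. unfold Q. apply Hqinc; [apply Hmin, Hx|apply Hmin, Hx|lra].
    - intros x Hx. unfold Q. rewrite Rmin_left by lra. apply Hqv.
      rewrite Rabs_left; lra.
    - intros x Hx Hvx p1 X1 d1 Hd1 Htouch.
      set (m := Rmin x (x0 + e)).
      assert (Hm := Hmin x ltac:(lra)). fold m in Hm.
      assert (Hloc1 : exists d2, 0 < d2 /\ forall y, Rabs (y - x) < d2 ->
        quad (Q x) (p + Y * (m - x0)) Y x y <= Q y).
      { destruct Hcase as [[Her HY]|(E0 & Ep & HY)].
        - assert (Hxr : x < x0 + r).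
          { apply Rnot_le_lt. intro Hge.
            assert (A := Hqv (x0 + r)
              ltac:(replace (x0 + r - x0) with r by ring; rewrite Rabs_pos_eq; lra)).
            assert (B := Hinc (x0 + r) x ltac:(lra) Hge).
            unfold Q in Hvx. rewrite Rmin_right, Her in Hvx by lra. lra. }
          exists (x0 + r - x). split; [lra|]. intros y Hy. apply Rabs_def2 in Hy.
          unfold m, Q. rewrite !Rmin_left by lra.
          unfold q. rewrite <- quad_rebase. apply Rle_refl.
        - exists 1. split; [lra|]. intros y _. unfold Q. fold m.
          set (my := Rmin y (x0 + e)).
          (* Freezing only shortens the distance to [x0]; as [Y < 0], the parabola continued from
             [x] therefore lies below [Q]. *)
          assert (Hsq : (my - x0) ^ 2 <= (m - x0 + (y - x)) ^ 2).
          { unfold my, m, Rmin. rewrite E0, Rplus_0_r.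
            destruct (Rle_dec y x0).
            - destruct (Rle_dec x x0); [apply Req_le; ring|].
              rewrite <- (pow2_abs (y - x0)), <- (pow2_abs (x0 - x0 + (y - x))).
              apply pow_incr. rewrite !Rabs_left1 by lra. lra.
            - replace ((x0 - x0) ^ 2) with 0 by ring. apply pow2_ge_0. }
          unfold q, quad. rewrite Ep. nra. }
      destruct Hloc1 as [d2 [Hd2 Hloc1]].
      (* A parabola above [Q] is also above the one found below [Q]: the slopes agree and [Y <= X1],
         so [G <= Y] at the contact suffices. *)
      destruct (quad_touch (Q x) (p + Y * (m - x0)) Y p1 X1 x (Rmin d1 d2))
        as [-> HYX].
      { apply Rmin_pos; assumption. }
      { intros y Hy. apply Rle_trans with (Q y).
        - apply Hloc1, (Rlt_le_trans _ _ _ Hy), Rmin_r.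
        - apply Htouch, (Rlt_le_trans _ _ _ Hy), Rmin_l. }
      assert (Hh : Rabs (m - x0) <= r) by (apply Rabs_le_between; lra).
      assert (B1 := HYr _ Hh).
      assert (B2 : Rabs (p * (m - x0)) <= p * r).
      { rewrite Rabs_mult, (Rabs_pos_eq p) by lra. apply Rmult_le_compat_l; lra. }
      assert (B3 : Rabs (Y * (m - x0) * (m - x0)) <= Rabs Y * r).
      { rewrite Rabs_mult. assert (C := Rabs_pos (m - x0)).
        assert (C' := Rabs_pos (Y * (m - x0))).
        apply Rle_trans with (Rabs (Y * (m - x0)) * 1); [|lra].
        apply Rmult_le_compat_l; lra. }
      apply Rabs_le_between in B1, B2, B3.
      assert (0 <= p * r) by (apply Rmult_le_pos; lra).
      assert (0 <= Rabs Y * r) by (apply Rmult_le_pos; lra).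
      assert (C1 : Rabs (Q x - v0) <= tau).
      { unfold Q, q, quad. fold m. apply Rabs_le_between.
        replace (Y / 2 * (m - x0) ^ 2) with (Y * (m - x0) * (m - x0) / 2) by field.
        lra. }
      assert (C2 : Rabs (p + Y * (m - x0) - p) <= tau) by (apply Rabs_le_between; lra).
      assert (C3 := proj2 HG (p + Y * (m - x0)) p (Q x) v0).
      assert (C4 := Rle_abs (G (p + Y * (m - x0)) (Q x) - G p v0)).
      assert (L * (Rabs (p + Y * (m - x0) - p) + Rabs (Q x - v0)) <= L * (2 * tau))
        by (apply Rmult_le_compat_l; lra).
      unfold gap in *. lra. }
  unfold Q in HQv. rewrite Rmin_left in HQv by lra.
  unfold q, quad in HQv. rewrite Rminus_diag in HQv. lra.
Qed.

(** * Barriers and the maximal subsolution *)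

Lemma exp_nondecreasing (x y : R) : x <= y -> exp x <= exp y.
Proof.
  intros H. apply Rnot_lt_le. intro E. apply exp_lt_inv in E. lra.
Qed.

Lemma psi_low_nonneg (x : R) : 0 <= x -> 0 <= psi_low x.
Proof.
  intros Hx. unfold psi_low. assert (exp (- x) <= exp 0) by (apply exp_nondecreasing; lra).
  rewrite exp_0 in *. lra.
Qed.

Lemma psi_low_classL : classL psi_low.
Proof.
  split.
  - intros x y Hx Hxy. unfold psi_low.
    assert (exp (- y) <= exp (- x)) by (apply exp_nondecreasing; lra). lra.
  - exists 1. intros x Hx. rewrite Rabs_pos_eq by (apply psi_low_nonneg, Hx).
    unfold psi_low. assert (A := exp_pos (- x)). lra.
Qed.

Lemma psi_up_le (M A b x : R) : 0 < M -> 0 < A -> psi_up M A b x <= A / M.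
Proof.
  intros HM HA. unfold psi_up.
  assert (0 < A / M) by (apply Rdiv_lt_0_compat; assumption).
  assert (B := exp_pos (- M * Rmin x b)). nra.
Qed.

Lemma psi_up_classL (M A b : R) : 0 < M -> 0 < A -> 0 < b -> classL (psi_up M A b).
Proof.
  intros HM HA Hb. assert (H : 0 < A / M) by (apply Rdiv_lt_0_compat; assumption).
  assert (Hinc : forall x y, 0 <= x -> x <= y -> psi_up M A b x <= psi_up M A b y).
  { intros x y Hx Hxy. unfold psi_up. apply Rmult_le_compat_l; [lra|].
    assert (B := Rle_min_compat_r _ _ b Hxy).
    assert (exp (- M * Rmin y b) <= exp (- M * Rmin x b)) by (apply exp_nondecreasing; nra). lra. }
  split; [exact Hinc|].
  exists (A / M). intros x Hx. rewrite Rabs_pos_eq; [apply psi_up_le; assumption|].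
  apply Rle_trans with (2 := Hinc 0 x (Rle_refl 0) Hx). unfold psi_up.
  rewrite Rmin_left by lra. rewrite Rmult_0_r, exp_0. lra.
Qed.

(** Provides the continuity demanded by [familyF] for [psi_low] and for the competitors in the
    maximality argument, which are only known to be semicontinuous. *)
Lemma classL_visc_sub_cont (mu sigma c a lambda : R) (u : R -> R) :
  0 < sigma -> 0 < c -> 0 < a -> 0 < lambda ->
  classL u -> visc_sub mu sigma c a lambda u -> cont_on u.
Proof.
  intros Hs Hc Ha Hl [Hinc [K HK]] Hsub.
  assert (HG := jet_sub_lip2 sigma c _ _ Hs Hc (fH_lipschitz mu a lambda Ha Hl)).
  destruct (upper_jets_right_slope _ _ K HG (bounded_on_nonneg u K HK))
    as (rho & N & Hrho & HN & H).
  apply (increasing_right_lipschitz_cont u rho N); try assumption.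
  apply H; [apply Hsub| |exact HK].
  apply (visc_sub_upper_jets _ _ _ _ _ K); assumption.
Qed.

Theorem mainTheorem6 (mu sigma c a lambda M A b : R) :
  assumptionA mu sigma c a lambda ->
  0 < M -> 0 < A -> 0 < b ->
  visc_sub mu sigma c a lambda psi_low ->
  visc_super mu sigma c a lambda (psi_up M A b) ->
  (forall x, 0 <= x -> psi_low x <= psi_up M A b x) ->
  (forall vbar vlow : R -> R,
      visc_super mu sigma c a lambda vbar -> classL vbar ->
      visc_sub mu sigma c a lambda vlow -> classL vlow ->
      forall x, 0 <= x -> vlow x <= vbar x) /\
  (forall x, 0 <= x ->
      usc_env (vhat mu sigma c a lambda M A b) x = vhat mu sigma c a lambda M A b x /\
      lsc_env (vhat mu sigma c a lambda M A b) x = vhat mu sigma c a lambda M A b x) /\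
  visc_sol mu sigma c a lambda (vhat mu sigma c a lambda M A b) /\
  classL (vhat mu sigma c a lambda M A b) /\
  (forall w : R -> R, visc_sol mu sigma c a lambda w -> classL w ->
      forall x, 0 <= x -> w x = vhat mu sigma c a lambda M A b x).
Proof.
  intros (Hs & Hc & Ha & Hl & _) HM HA Hb Hlow Hup Hlu.
  assert (Hcomp : forall vbar vlow : R -> R,
      visc_super mu sigma c a lambda vbar -> classL vbar ->
      visc_sub mu sigma c a lambda vlow -> classL vlow ->
      forall x, 0 <= x -> vlow x <= vbar x)
    by (intros; apply (visc_comparison mu sigma c a lambda); assumption).
  split; [exact Hcomp|].
  assert (HupL := psi_up_classL M A b HM HA Hb).
  set (F := familyF mu sigma c a lambda M A b).
  set (v := vhat mu sigma c a lambda M A b).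
  set (K := A / M).
  assert (HG := jet_sub_lip2 sigma c _ _ Hs Hc (fH_lipschitz mu a lambda Ha Hl)).
  set (G := jet_sub sigma c (fH mu a lambda)) in *.
  assert (HK0 : 0 <= K) by (apply Rlt_le, Rdiv_lt_0_compat; assumption).
  assert (HFK : forall u x, F u -> 0 <= x -> 0 <= u x <= K).
  { intros u x (_ & _ & _ & Hu) Hx. assert (A1 := Hu x Hx).
    assert (A2 := psi_low_nonneg x Hx). assert (A3 := psi_up_le M A b x HM HA).
    unfold K; lra. }
  (* The lower barrier makes the family nonempty, so the supremum defining [vhat] is finite. *)
  assert (HFlow : F psi_low).
  { split; [|split; [exact psi_low_classL|split; [exact Hlow|]]].
    - apply (classL_visc_sub_cont mu sigma c a lambda); try assumption.
      exact psi_low_classL.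
    - intros x Hx. split; [apply Rle_refl|apply Hlu, Hx]. }
  assert (Hv : forall x, 0 <= x ->
    (forall u, F u -> u x <= v x) /\
    (forall m, (forall u, F u -> u x <= m) -> v x <= m)).
  { intros x Hx.
    destruct (Lub_Rbar_real (fun r => exists u, F u /\ r = u x) K) as [L1 L2].
    - exists (psi_low x), psi_low. auto.
    - intros r (u & Fu & ->). apply (HFK u x Fu Hx).
    - split.
      + intros u Fu. apply L1. exists u. auto.
      + intros m Hm. apply L2. intros r (u & Fu & ->). apply Hm, Fu. }
  assert (Hv0 : v 0 = 0).
  { assert (H0 : forall u, F u -> u 0 = 0) by (intros u (_ & _ & Hu & _); apply Hu).
    destruct (Hv 0 (Rle_refl 0)) as [V1 V2]. apply Rle_antisym.
    - apply V2. intros u Fu. rewrite (H0 u Fu). lra.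
    - rewrite <- (H0 psi_low HFlow) at 1. apply V1, HFlow. }
  assert (Hvinc : forall x y, 0 <= x -> x <= y -> v x <= v y).
  { intros x y Hx Hxy. apply (Hv x Hx). intros u Fu.
    apply Rle_trans with (u y); [apply Fu; assumption|apply Hv; [lra|exact Fu]]. }
  assert (Hvb : forall x, 0 <= x -> psi_low x <= v x <= psi_up M A b x).
  { intros x Hx. split; [apply Hv; [exact Hx|exact HFlow]|].
    apply (Hv x Hx). intros u Fu. apply Fu, Hx. }
  assert (HvK : bounded_on v K).
  { intros x Hx. destruct (Hv x Hx) as [V1 V2].
    assert (A1 := HFK psi_low x HFlow Hx). assert (A2 := V1 psi_low HFlow).
    assert (A3 : v x <= K) by (apply V2; intros u Fu; apply (HFK u x Fu Hx)).
    rewrite Rabs_pos_eq; lra. }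
  assert (HvL : classL v) by (split; [exact Hvinc|exists K; exact HvK]).
  assert (HFJ : forall u, F u -> usc_on u /\ upper_jets G u /\ bounded_on u K).
  { intros u Fu. assert (HuK : bounded_on u K).
    { intros x Hx. assert (B := HFK u x Fu Hx). rewrite Rabs_pos_eq; lra. }
    split; [apply Fu|]. split; [|exact HuK].
    apply (visc_sub_upper_jets _ _ _ _ _ K); [assumption|exact HuK|apply Fu]. }
  assert (Hvc : cont_on v).
  { destruct (upper_jets_right_slope G _ K HG HK0) as (rho & N & Hrho & HN & Hlip).
    apply (increasing_right_lipschitz_cont v rho N); try assumption.
    intros x y Hx Hy. apply (Hv y ltac:(lra)). intros u Fu.
    destruct (HFJ u Fu) as (U1 & U2 & U3).
    assert (B := Hlip u U1 U2 U3 x y Hx Hy).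
    assert (C := proj1 (Hv x Hx) u Fu). lra. }
  assert (HvJ : upper_jets G v).
  { apply (sup_upper_jets G _ F v HG).
    - intros u Fu. destruct (HFJ u Fu) as (U1 & U2 & _). split; assumption.
    - intros u x Fu Hx. apply Hv; assumption.
    - intros x m Hx. apply Hv, Hx. }
  assert (Hvsub : visc_sub mu sigma c a lambda v)
    by (apply upper_jets_visc_sub; try assumption; apply cont_on_usc, Hvc).
  assert (Hvmax : maximal_subsolution G v).
  { split; [apply cont_on_usc, Hvc|]. split; [exact Hv0|]. split; [exact HvL|].
    split; [exact HvJ|]. intros w Hw1 Hw2 Hw3 Hw4 Hw5 x Hx.
    assert (Hwsub : visc_sub mu sigma c a lambda w)
      by (apply upper_jets_visc_sub; assumption).
    apply (Hv x Hx). split; [|split; [exact Hw3|split; [exact Hwsub|]]].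
    - apply (classL_visc_sub_cont mu sigma c a lambda); assumption.
    (* The bound by [psi_up] is comparison with a supersolution of class (L); the bound by [psi_low]
       is inherited from [v]. *)
    - intros y Hy. split; [|apply Hcomp; assumption].
      apply Rle_trans with (v y); [apply Hvb, Hy|apply Hw5, Hy]. }
  assert (Hvsuper : visc_super mu sigma c a lambda v).
  { apply upper_jets_visc_super; try assumption; [apply cont_on_lsc, Hvc|].
    exact (maximal_subsolution_super G _ v HG Hvmax). }
  split; [|split; [|split]].
  - intros x Hx. split.
    + apply usc_env_cont with K; assumption.
    + apply lsc_env_cont with K; assumption.
  - split; [exact Hvc|]. split; assumption.
  - exact HvL.
  - intros w (_ & Wsub & Wsuper) WL x Hx. apply Rle_antisym; apply Hcomp; assumption.
Qed.
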